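(* Let $\mathcal{S}$ denote the support of the law of the $C([0,1])$-valued random variable $$\mathrm{K}(t)=t\,\mathrm{ST}_0+\sum_{h\neq 0}\frac{e(ht)-1}{2\pi i h}\mathrm{ST}_h,\qquad 0\le t\le 1.$$ Then $\mathcal{S}$ is exactly the set of all $f\in C([0,1])$ such that $f(0)=0$, $f(1)\in[-2,2]$, and such that the function $g(t)=f(t)-tf(1)$ satisfies, for every non-zero integer $h$, $$\widehat{g}(h)\in i\mathbf{R}\quad\text{and}\quad |\widehat{g}(h)|\le \frac{1}{\pi|h|},$$ where $\widehat{g}(h)=\int_0^1 g(t)e(-ht)\,dt$.
   Context: $e(z)=e^{2i\pi z}$. $C([0,1])$ is the Banach space of continuous complex-valued functions on $[0,1]$ with the sup norm. $(\mathrm{ST}_h)_{h\in\mathbf{Z}}$ is a family of independent real random variables, each with the Sato–Tate law $\frac{1}{\pi}\sqrt{1-\frac{x^2}{4}}\,dx$ on $[-2,2]$; the series defining $\mathrm{K}$ converges almost surely uniformly on $[0,1]$ in the sense of symmetric partial sums (over $|h|\le N$, $N\to\infty$), so $\mathrm{K}$ is a $C([0,1])$-valued random variable. The support of its law is the set of $f\in C([0,1])$ such that every open neighbourhood of $f$ has positive probability. *)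

(* Defs.v *)
From HB Require Import structures.
From mathcomp Require Import all_boot all_order all_algebra.
From mathcomp Require Import all_classical all_reals all_analysis.
From mathcomp Require Import complex.

Set Implicit Arguments.
Unset Strict Implicit.
Unset Printing Implicit Defensive.

Import Order.TTheory GRing.Theory Num.Theory.
Import numFieldNormedType.Exports numFieldTopology.Exports.

Local Open Scope classical_set_scope.
Local Open Scope ring_scope.
Local Open Scope complex_scope.

Definition ee {R : realType} (x : R) : R[i] :=
  (cos (2 * pi * x)) +i* (sin (2 * pi * x)).

Definition fourier_coef {R : realType} (g : R -> R[i]) (h : int) : R[i] :=
  (Rintegral lebesgue_measure `[0%R, 1%R]
     (fun t => complex.Re (g t * ee (- (h%:~R * t))))) +i*
  (Rintegral lebesgue_measure `[0%R, 1%R]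
     (fun t => complex.Im (g t * ee (- (h%:~R * t))))).

Definition mutually_independent {d : measure_display} {T : measurableType d}
  {R : realType} (P : probability T R) (X : int -> T -> R) : Prop :=
  forall (J : seq int) (B : int -> set R),
    uniq J -> (forall j, measurable (B j)) ->
    P (\big[setI/setT]_(j <- J) (X j @^-1` B j)) =
    (\prod_(j <- J) P (X j @^-1` B j))%E.

Definition sato_tate_law {d : measure_display} {T : measurableType d}
  {R : realType} (P : probability T R) (X : T -> R) : Prop :=
  forall A : set R, measurable A ->
    P (X @^-1` A) =
    (\int[lebesgue_measure]_(x in A `&` `[(-2)%R, 2%R])
       ((Num.sqrt (1 - x ^+ 2 / 4)) / pi)%:E)%E.

Definition K_partial {T : Type} {R : realType} (ST : int -> T -> R)
  (N : nat) (w : T) (t : R) : R[i] :=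
  let term (h : int) : R[i] :=
    (ee (h%:~R * t) - 1) / ((2 * pi * h%:~R)%:C * 'i) * (ST h w)%:C in
  (t * ST 0 w)%:C + \sum_(1 <= n < N.+1) (term (Posz n) + term (- Posz n)).

(* The sup-norm ball of radius eps around f in C([0,1]) (restricted to [0,1]);
   continuous functions on [0,1] attain their sup, so for continuous k, f this
   is exactly  sup_{[0,1]} |k - f| < eps. *)
Definition sup_ball {R : realType} (f : R -> R[i]) (eps : R) (k : R -> R[i]) :=
  forall t, t \in `[0%R, 1%R] -> `|k t - f t| < eps%:C.

Definition K_unif_limit {T : Type} {R : realType} (ST : int -> T -> R)
  (w : T) (k : R -> R[i]) :=
  forall eps : R, 0 < eps -> exists N0 : nat, forall N, (N0 <= N)%N ->
    forall t, t \in `[0%R, 1%R] -> `|K_partial ST N w t - k t| < eps%:C.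

(* f lies in the support of the law of K: every (sup-norm ball) neighbourhood
   of f has positive probability under the law of K = a.s. uniform limit of
   the symmetric partial sums. *)
Definition in_support_K {d : measure_display} {T : measurableType d}
  {R : realType} (P : probability T R) (ST : int -> T -> R) (f : R -> R[i]) :=
  forall eps : R, 0 < eps ->
    (0 < P [set w | exists k : R -> R[i], K_unif_limit ST w k /\ sup_ball f eps k])%E.

(* Main.v *)
Require Import Defs.
From HB Require Import structures.
From mathcomp Require Import all_boot all_order all_algebra.
From mathcomp Require Import all_classical all_reals all_analysis.
From mathcomp Require Import measurable_realfun complex.
From mathcomp Require Import ring lra zify.

(* Write x_h for the value of ST_h, so that K is the uniform limit of the
   partial sums K_N, with
     Re K_N(t) = t x_0 + sum_{n <= N} sin(2 pi n t) / (2 pi n) (x_n + x_{-n}),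
     Im K_N(t) = sum_{n <= N} (1 - cos(2 pi n t)) / (2 pi n) (x_n - x_{-n}).

   A function in the support is a uniform limit of such sums with all x_h in
   [-2, 2]; the h-th Fourier coefficient of K_N(t) - t K_N(1) is
   x_h / (2 i pi h), and the conditions of the theorem are closed under uniform
   limits.

   Conversely, if g(t) = f(t) - t f(1) satisfies the conditions, its Fejer means
   are, up to their value at 0, partial sums K_N with coefficients
   (1 - |h| / N) 2 i pi h g^(h), which lie in [-2, 2].  As the Sato-Tate density
   is positive on ]-2, 2[, finitely many variables fall close to these
   coefficients with positive probability.  Given this event, the tail of the
   series is uniformly small with positive probability: on the block of
   frequencies 16^m <= n < 16^(m+1), Chernoff's bound and a union bound over all
   partial sums and over the grid of step 32^(-m) show that the partial sums of
   the block exceed a constant times 2^(-m) with probability O(2^(-m)). *)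

Set Implicit Arguments.
Unset Strict Implicit.
Unset Printing Implicit Defensive.

Import Order.TTheory GRing.Theory Num.Theory.
Import numFieldNormedType.Exports numFieldTopology.Exports.

Local Open Scope classical_set_scope.
Local Open Scope ring_scope.
Local Open Scope complex_scope.

(** * Independent Sato-Tate variables *)

(** [in_support_K] quantifies over a limit function [k], while comparing probabilities by inclusion
    requires measurable events. Uniform convergence is therefore restated as a Cauchy condition with
    countable quantifiers, and bounds on [0,1] are tested at rational points. Convergence of the
    series is part of the favourable event and comes from the same block bounds. Independence is
    given as a product formula for events. Conditioning is thus expressed by inequalities P(A and
    Bad) <= c P(A), with A a cylinder on low frequencies and c independent of A: the prescribed low
    frequencies may be extremely unlikely, but c = 1/2 is enough because P(A) is a factor of the
    bound. The scales are powers of q = 2^m. A block has about q^4 frequencies with coefficients of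
    size at most q^-4, so its partial sums deviate by about q^-2, and the threshold q^-1 leaves a
    factor q for the exponential bound. The basis functions are 1-Lipschitz at every frequency, so a
    block sum varies by O(q^4 q^-5) = O(q^-1) between neighbours of the grid of step q^-5. *)

Section density_transfer.
Context d (T : measurableType d) d' (T' : measurableType d') (R : realType).
Import HBNNSimple.

(** The hypothesis on sets says that the image under [X] of the measure with density [Y] on [D] is
    [k] times [nu]; simple functions and monotone convergence extend it to [phi]. It serves twice:
    with [Y] the Sato-Tate density, and with [Y] a product over the remaining independent
    variables. *)
Lemma ge0_integral_density_comp (mu : {measure set T -> \bar R})
    (nu : {measure set T' -> \bar R}) (D : set T) (X : T -> T') (Y : T -> R)
    (k : R) (phi : T' -> R) :
  measurable D -> measurable_fun setT X -> measurable_fun setT Y ->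
  (forall x, 0 <= Y x) -> 0 <= k ->
  (forall B, measurable B ->
     \int[mu]_(x in D `&` X @^-1` B) (Y x)%:E = k%:E * nu B)%E ->
  measurable_fun setT phi -> (forall x, 0 <= phi x) ->
  (\int[mu]_(x in D) (phi (X x) * Y x)%:E = k%:E * \int[nu]_x (phi x)%:E)%E.
Proof.
move=> mD mX mY Y0 k0 H mphi phi0.
have mphiE : measurable_fun setT (fun x => (phi x)%:E) by exact/measurable_EFinP.
pose h := nnsfun_approx measurableT mphiE.
have hX n : measurable_fun setT (h n \o X) by exact: measurableT_comp.
have cvgh x : (h n x)%:E @[n --> \oo] --> (phi x)%:E.
  by apply: (@cvg_nnsfun_approx _ _ _ _ measurableT _ mphiE) => // y _; rewrite lee_fin.
have -> : (\int[nu]_x (phi x)%:E = lim (\int[nu]_x (h n x)%:E @[n --> \oo]))%E.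
  under eq_integral => x _ do rewrite -(cvg_lim _ (cvgh x))//.
  apply: monotone_convergence => //.
  - by move=> n; exact/measurable_EFinP.
  - by move=> n x _; rewrite lee_fin.
  - by move=> x _ a b ab; rewrite lee_fin; exact/lefP/nd_nnsfun_approx.
have -> : (\int[mu]_(x in D) (phi (X x) * Y x)%:E =
           lim (\int[mu]_(x in D) (h n (X x) * Y x)%:E @[n --> \oo]))%E.
  have phiY x : ((h n (X x) * Y x)%:E @[n --> \oo] --> (phi (X x) * Y x)%:E)%E.
    under eq_fun do rewrite EFinM.
    by rewrite EFinM; apply: cvgeZr => //; exact: cvgh.
  under eq_integral => x _ do rewrite -(cvg_lim _ (phiY x))//.
  apply: monotone_convergence => //.
  - move=> n; apply/measurable_EFinP/measurable_funTS.
    exact: (measurable_funM (hX n) mY).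
  - by move=> n x _; rewrite lee_fin mulr_ge0.
  - move=> x _ a b ab; rewrite lee_fin ler_wpM2r//.
    exact/lefP/nd_nnsfun_approx.
suff suf n : (\int[mu]_(x in D) (h n (X x) * Y x)%:E = k%:E * \int[nu]_x (h n x)%:E)%E.
  under eq_fun do rewrite suf.
  apply: cvg_lim => //; apply: cvgeZl => //.
  apply: ereal_nondecreasing_is_cvgn => i j ij; apply: ge0_le_integral => //.
  - by move=> x _; rewrite lee_fin.
  - exact/measurable_EFinP.
  - exact/measurable_EFinP.
  - by move=> x _; rewrite lee_fin; exact/lefP/nd_nnsfun_approx.
have hE x : ((h n x)%:E = \sum_(y \in range (h n)) (y * \1_(h n @^-1` [set y]) x)%:E)%E.
  by rewrite fsumEFin// -fimfunE.
have r0 y : y \in range (h n) -> 0 <= y by rewrite inE => -[t _ <-].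
under [in RHS]eq_integral do rewrite hE.
have mind (y : R) : measurable_fun setT (\1_(h n @^-1` [set y]) : T' -> R).
  exact: measurable_indic.
rewrite ge0_integral_fsum//; last 2 first.
  - by move=> y; apply/measurable_EFinP; exact: measurable_funM.
  - by move=> m y Ey; exact: nnfun_muleindic_ge0.
rewrite ge0_mule_fsumr; last first.
  by move=> y; apply: integral_ge0 => x _; exact: nnfun_muleindic_ge0.
have mE y : measurable_fun D (fun x => (y * \1_(h n @^-1` [set y]) (X x) * Y x)%:E).
  apply/measurable_EFinP/measurable_funTS/measurable_funM => //.
  apply: measurable_funM => //.
  exact: (measurableT_comp (mind y) mX).
transitivity (\int[mu]_(x in D) (\sum_(y \in range (h n))
    (y * \1_(h n @^-1` [set y]) (X x) * Y x)%:E))%E.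
  apply: eq_integral => x xD.
  rewrite EFinM hE ge0_mule_fsuml => [|y]; last exact: nnfun_muleindic_ge0.
  by under eq_fsbigr do rewrite -EFinM.
rewrite ge0_integral_fsum//; last first.
  move=> m y Ey; rewrite EFinM mule_ge0 ?lee_fin//.
  by rewrite -lee_fin; exact: nnfun_muleindic_ge0.
apply: eq_fsbigr => r /r0 rge0.
under [in RHS]eq_integral do rewrite EFinM.
rewrite integralZl_indic_nnsfun//.
rewrite integral_indic// setIT.
under eq_integral do rewrite -mulrA EFinM.
rewrite ge0_integralZl//; last 2 first.
- apply/measurable_EFinP/measurable_funTS/measurable_funM => //.
  exact: (measurableT_comp (mind r) mX).
- by move=> t Et; rewrite lee_fin mulr_ge0.
rewrite muleCA -H//; congr (_ * _)%E.
rewrite integral_mkcondr; apply: eq_integral => x _.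
rewrite patchE /= indicE.
have -> : (X x \in h n @^-1` [set r]) = (x \in X @^-1` (h n @^-1` [set r])).
  by apply/idP/idP; rewrite !inE.
by case: ifP => _; rewrite ?mul1r ?mul0r.
Qed.

End density_transfer.

(** From [1 - y <= expR (- y)] one gets [expR y <= (1 - y)^-1], and (1 - y)(1 + y + 2 y^2) = 1 + y^2
    (1 - 2 y) is at least 1. *)
Lemma expR_le_quad (R : realType) (y : R) : y <= 2^-1 ->
  expR y <= 1 + y + 2 * y ^+ 2.
Proof.
move=> y2; have := expR_ge1Dx (- y); rewrite expRN => h.
have e0 := expR_gt0 y.
have h1 : 1 - y > 0 by lra.
have : expR y <= (1 - y)^-1 by rewrite -[expR y]invrK lef_pV2// posrE invr_gt0.
move/le_trans; apply; rewrite -[X in X <= _]mul1r ler_pdivrMr//.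
nra.
Qed.

Section sato_tate.
Context (R : realType).

(** As [Num.sqrt] is 0 at negative reals, this is continuous on the whole line and vanishes outside
    [-2, 2]. *)
Let rho (x : R) : R := Num.sqrt (1 - x ^+ 2 / 4) / pi.

Lemma sato_tate_density_continuous : continuous rho.
Proof.
move=> x; apply: cvgM; last exact: cvg_cst.
apply: (@continuous_comp R R R (fun x : R => 1 - x ^+ 2 / 4) Num.sqrt); last exact: sqrt_continuous.
apply: cvgB; first exact: cvg_cst.
by apply: cvgM; [exact: exprn_continuous|exact: cvg_cst].
Qed.

Lemma sato_tate_density_ge0 x : 0 <= rho x.
Proof. by rewrite mulr_ge0// ?sqrtr_ge0// invr_ge0 pi_ge0. Qed.

Lemma sato_tate_integrable (u : R -> R) : continuous u ->
  (@lebesgue_measure R).-integrable `[(-2)%R, 2%R] (EFin \o (fun x => u x * rho x)).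
Proof.
move=> cu; apply: continuous_compact_integrable; first exact: segment_compact.
apply: continuous_subspaceT => x; apply: cvgM; first exact: cu.
exact: sato_tate_density_continuous.
Qed.

Let id_continuous : continuous (@id R).
Proof. by move=> x; exact: cvg_id. Qed.

(** The density is even, so the substitution of -x for x turns the integral into its opposite. *)
Lemma sato_tate_mean0 :
  (\int[lebesgue_measure]_(x in `[(-2)%R, 2%R]) (x * rho x)%:E = 0)%E.
Proof.
have int := @sato_tate_integrable id id_continuous.
have fin := integrable_fin_num _ int.
have cG : continuous (fun x : R => x * rho x).
  by move=> x; apply: cvgM; [exact: cvg_id|exact: sato_tate_density_continuous].
have := @integration_by_substitution_oppr R (fun x => x * rho x) (-2) 2.
rewrite opprK => /(_ _ _)/wrap[]; first lra.
  exact: continuous_subspaceT.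
under [X in _ = X -> _]eq_integral => x _.
  rewrite /= (_ : - x * rho (- x) = (-1) * (x * rho x)); last first.
    by rewrite /rho sqrrN; ring.
  rewrite EFinM; over.
rewrite integralZl//.
move: (fin ltac:(exact: measurable_itv)); case: (integral _ _ _) => // r _ [] h; congr EFin; lra.
Qed.

Context d (T : measurableType d) (P : probability T R) (X : T -> R).
Hypothesis mX : measurable_fun setT X.
Hypothesis lawX : sato_tate_law P X.

Lemma sato_tate_expectation (phi : R -> R) :
  measurable_fun setT phi -> (forall x, 0 <= phi x) ->
  (\int[P]_w (phi (X w))%:E =
   \int[lebesgue_measure]_(x in `[(-2)%R, 2%R]) (phi x * rho x)%:E)%E.
Proof.
move=> mphi phi0.
have mrho : measurable_fun setT rho.
  exact: (continuous_measurable_fun sato_tate_density_continuous).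
have := @ge0_integral_density_comp _ _ _ _ R lebesgue_measure
  (pushforward P X) `[(-2)%R, 2%R] id rho 1 phi.
move=> -> //.
- rewrite mul1e ge0_integral_pushforward//.
  + exact/measurable_EFinP.
  + by move=> y _; rewrite lee_fin.
- exact: sato_tate_density_ge0.
- by move=> B mB; rewrite mul1e /= /pushforward lawX// setIC.
Qed.

(** On [-2, 2] the product [s * x] is at most 1/2, so the quadratic bound on [expR] applies; its
    linear term integrates to 0 and its quadratic term is at most 8 s^2. *)
Lemma sato_tate_laplace (s : R) : `|s| <= 4^-1 ->
  (\int[P]_w (expR (s * X w))%:E <= (1 + 8 * s ^+ 2)%:E)%E.
Proof.
move=> s4.
have cs : continuous (fun x : R => expR (s * x)).
  move=> x; apply: (@continuous_comp R R R (fun x : R => s * x) expR); last exact: continuous_expR.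
  by apply: cvgM; [exact: cvg_cst|exact: cvg_id].
rewrite (@sato_tate_expectation (fun x => expR (s * x))); last 2 first.
- exact: continuous_measurable_fun.
- by move=> x; exact: expR_ge0.
have i1 := @sato_tate_integrable (cst (1 + 8 * s ^+ 2)) (@cst_continuous _ _ _).
have i2 := @sato_tate_integrable id id_continuous.
have i3 := @sato_tate_integrable (fun x => expR (s * x)) cs.
have one : (\int[lebesgue_measure]_(x in `[(-2)%R, 2%R]) (rho x)%:E = 1)%E.
  by have := lawX measurableT; rewrite setTI preimage_setT probability_setT => <-.
have i4 : (@lebesgue_measure R).-integrable `[(-2)%R, 2%R]
    (fun x => s%:E * (x * rho x)%:E)%E by exact: integrableZl.
have -> : (1 + 8 * s ^+ 2)%:E = (\int[lebesgue_measure]_(x in `[(-2)%R, 2%R])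
   (((1 + 8 * s ^+ 2) * rho x)%:E + s%:E * (x * rho x)%:E))%E.
  rewrite integralD//= integralZl// sato_tate_mean0 mule0 adde0.
  under eq_integral do rewrite EFinM.
  rewrite integralZl// ?one ?mule1//.
  have := @sato_tate_integrable (cst 1) (@cst_continuous _ _ _).
  by apply: eq_integrable => // x _ /=; rewrite mul1r.
apply: le_integral => //; first exact: integrableD.
move=> x; rewrite inE /= in_itv/= => /andP[x1 x2].
rewrite -EFinM -EFinD lee_fin (mulrA s) -mulrDl ler_wpM2r ?sato_tate_density_ge0//.
have [s1 s2] : - 4^-1 <= s /\ s <= 4^-1 by move: s4; rewrite ler_norml => /andP.
have sx : s * x <= 2^-1.
  have : `|s * x| <= 4^-1 * 2.
    by rewrite normrM ler_pM// ler_norml; apply/andP.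
  by move=> /(le_trans (ler_norm _)) h; lra.
have sx2 : (s * x) ^+ 2 <= 4 * s ^+ 2.
  by rewrite exprMn mulrC ler_wpM2r ?sqr_ge0//; nra.
by apply: le_trans (expR_le_quad sx) _ => /=; lra.
Qed.

Lemma sato_tate_support : P [set w | `|X w| <= 2%R] = 1%E.
Proof.
have -> : [set w | `|X w| <= 2%R] = X @^-1` `[(-2)%R, 2%R].
  by apply/seteqP; split => w /=; rewrite in_itv/= ler_norml.
have := lawX measurableT; rewrite setTI preimage_setT probability_setT => ->.
by rewrite lawX// setIid.
Qed.

Lemma sato_tate_ball_gt0 (y e : R) : -2 <= y <= 2 -> 0 < e ->
  (0 < P [set w | (`|X w - y| < e)%R])%E.
Proof.
move=> /andP[y1 y2] e0.
pose a := Num.max (-2) (y - e); pose b := Num.min 2 (y + e).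
have ab : a < b.
  by rewrite /a /b lt_min !gt_max; apply/andP; split; apply/andP; split; lra.
have a2 : -2 <= a /\ y - e <= a by rewrite /a !le_max !lexx orbT.
have b2 : b <= 2 /\ b <= y + e by rewrite /b !ge_min !lexx orbT.
(* The density vanishes at the ends -2 and 2, which may be [y] itself; the middle third stays away
   from them. *)
pose a' := a + (b - a) / 3; pose b' := a + (b - a) * 2 / 3.
have ab' : [/\ -2 < a', a' < b', b' < 2, y - e < a' & b' < y + e].
  by rewrite /a' /b'; split; lra.
case: ab' => a'2 ab' b'2 a'y b'y.
pose c := Num.min (rho a') (rho b').
have rpos x : -2 < x -> x < 2 -> 0 < rho x.
  move=> x1 x2; rewrite divr_gt0 ?pi_gt0// sqrtr_gt0; nra.
have c0 : 0 < c by rewrite /c lt_min !rpos//; lra.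
(* The density decreases in |x|, so its minimum over the segment is reached at an end, on the side
   given by the sign of [x]. *)
have cle x : a' <= x <= b' -> c <= rho x.
  move=> /andP[x1 x2]; rewrite /c ge_min; apply/orP.
  have [x0|x0] := leP 0 x; [right|left].
    by rewrite /rho ler_pM2r ?invr_gt0 ?pi_gt0// ler_wsqrtr//; nra.
  by rewrite /rho ler_pM2r ?invr_gt0 ?pi_gt0// ler_wsqrtr//; nra.
apply: (@lt_le_trans _ _ (\int[lebesgue_measure]_(x in `[a', b']) c%:E)%E).
  rewrite integral_cst//= lebesgue_measure_itv/= lte_fin ab' -EFinB -EFinM lte_fin.
  by rewrite mulr_gt0// subr_gt0.
have -> : [set w | (`|X w - y| < e)%R] = X @^-1` `]y - e, y + e[.
  by apply/seteqP; split => w /=; rewrite in_itv/= ltr_distl.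
rewrite lawX//.
apply: (@le_trans _ _ (\int[lebesgue_measure]_(x in `[a', b']) (rho x)%:E)%E).
  apply: ge0_le_integral => //.
  - by move=> x _; rewrite lee_fin ltW.
  - apply/measurable_EFinP/measurable_funTS.
    exact: (continuous_measurable_fun sato_tate_density_continuous).
apply: ge0_subset_integral => //.
- exact: measurableI.
- apply/measurable_EFinP/measurable_funTS.
  exact: (continuous_measurable_fun sato_tate_density_continuous).
- by move=> x _; rewrite lee_fin sato_tate_density_ge0.
- by move=> x /=; rewrite !in_itv/= => /andP[? ?]; split; apply/andP; split; lra.
Qed.

End sato_tate.

Section independence.
Context d (T : measurableType d) (R : realType) (P : probability T R).
Context (X : int -> T -> R).
Hypothesis mX : forall h, measurable_fun setT (X h).
Hypothesis indepX : mutually_independent P X.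

Let cyl (H : seq int) (B : int -> set R) : set T :=
  \big[setI/setT]_(j <- H) (X j @^-1` B j).

Lemma cylinder_measurable (H : seq int) (B : int -> set R) :
  (forall j, measurable (B j)) -> measurable (cyl H B).
Proof.
move=> mB; apply: bigsetI_measurable => j _.
by rewrite -[_ @^-1` _]setTI; exact: mX.
Qed.

Lemma measurable_fun_prod_comp (J : seq int) (phi : int -> R -> R) :
  (forall j, measurable_fun setT (phi j)) ->
  measurable_fun setT (fun w => \prod_(j <- J) phi j (X j w)).
Proof.
move=> mphi; elim: J => [|j J IH].
  by under eq_fun do rewrite big_nil; exact: measurable_cst.
under eq_fun do rewrite big_cons.
by apply: measurable_funM => //; exact: measurableT_comp.
Qed.

(* The density transfer lemma is applied to one variable at a time, with the
   events on the remaining variables kept in the cylinder. *)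
Lemma cylinder_expectation_prod (phi : int -> R -> R) (c : int -> R) :
  (forall j, measurable_fun setT (phi j)) -> (forall j x, 0 <= phi j x) ->
  (forall j, \int[P]_w (phi j (X j w))%:E = (c j)%:E)%E ->
  forall (J H : seq int) (B : int -> set R), uniq (H ++ J) ->
    (forall j, measurable (B j)) ->
  (\int[P]_(w in cyl H B) (\prod_(j <- J) phi j (X j w))%:E =
   P (cyl H B) * (\prod_(j <- J) c j)%:E)%E.
Proof.
move=> mphi phi0 Ec.
have c0 j : 0 <= c j.
  by rewrite -lee_fin -Ec; apply: integral_ge0 => x _; rewrite lee_fin.
elim=> [|j J IH] H B uHJ mB.
  under eq_integral do rewrite big_nil.
  rewrite integral_cst ?big_nil ?mul1e ?mule1//.
  exact: cylinder_measurable.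
under eq_integral do rewrite big_cons.
have [jH jJ uH uJ] : [/\ j \notin H, j \notin J, uniq (H ++ J) & uniq ((j :: H) ++ J)].
  have : perm_eq (H ++ j :: J) (j :: H ++ J) by rewrite perm_catC cat_cons perm_cons perm_catC.
  move=> /perm_uniq E; move: uHJ; rewrite E /= mem_cat negb_or => /andP[/andP[-> ->] ->].
  by split.
pose k := fine (P (cyl H B)) * \prod_(i <- J) c i.
have fP A : measurable A -> P A \is a fin_num by move=> mA; exact: fin_num_measure.
have mH := cylinder_measurable H mB.
have k0 : 0 <= k by rewrite mulr_ge0 ?fine_ge0 ?measure_ge0// prodr_ge0.
rewrite (@ge0_integral_density_comp _ _ _ _ R P (pushforward P (X j)) (cyl H B)
  (X j) (fun w => \prod_(i <- J) phi i (X i w)) k (phi j))//.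
- rewrite ge0_integral_pushforward//=; last 2 first.
  + exact/measurable_EFinP.
  + by move=> y _; rewrite lee_fin.
  rewrite preimage_setT Ec /k big_cons EFinM fineK ?fP// -muleA -EFinM.
  by rewrite [in RHS]mulrC.
- exact: measurable_fun_prod_comp.
- by move=> x; exact: prodr_ge0.
(* The event on [X j] is absorbed into a cylinder over [j :: H], to which the induction hypothesis
   for [J] applies; [indepX] then splits this event off again. *)
- move=> A mA; pose B' i := if i == j then A else B i.
  have mB' i : measurable (B' i) by rewrite /B'; case: ifP.
  have cylE : cyl H B' = cyl H B.
    apply: eq_big_seq => i iH; rewrite /B' ifF//.
    by apply: contraNF jH => /eqP <-.
  have cylE' : cyl H B `&` X j @^-1` A = cyl (j :: H) B'.
    by rewrite /cyl big_cons -/(cyl H B') cylE /B' eqxx setIC.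
  rewrite cylE' IH//.
  have uHj : uniq (j :: H) by move: uJ; rewrite cat_uniq => /andP[].
  have uH' : uniq H by move: uHj => /= /andP[].
  rewrite indepX// big_cons /B' eqxx.
  rewrite (_ : (\prod_(i <- H) _)%E = P (cyl H B)); last first.
    rewrite /cyl indepX//; apply: eq_big_seq => i iH; rewrite ifF//.
    by apply: contraNF jH => /eqP <-.
  by rewrite /k EFinM fineK ?fP// /= /pushforward -muleA muleC.
Qed.

(** Markov's inequality for the exponential of [s] times the sum, integrated over the cylinder only.
    Each factor has expectation at most 1 + 8 (s a_j)^2, hence at most the exponential of 8 (s
    a_j)^2. *)
Lemma cylinder_chernoff (a : int -> R) (s l : R) (J H : seq int) (B : int -> set R) :
  (forall j, sato_tate_law P (X j)) -> uniq (H ++ J) ->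
  (forall j, measurable (B j)) -> 0 <= s ->
  (forall j, j \in J -> `|s * a j| <= 4^-1) ->
  (P (cyl H B `&` [set w | (l <= \sum_(j <- J) a j * X j w)%R]) <=
   P (cyl H B) * (expR (8 * s ^+ 2 * (\sum_(j <- J) a j ^+ 2) - s * l))%:E)%E.
Proof.
move=> lawX uHJ mB s0 sa.
have mH := cylinder_measurable H mB.
(* The product formula asks for a finite expectation at every index; outside [J] a zero coefficient
   makes the factor 1. *)
pose a' j := if j \in J then a j else 0.
have sa' j : `|s * a' j| <= 4^-1.
  by rewrite /a'; case: ifPn => [/sa//|_]; rewrite mulr0 normr0 invr_ge0.
pose phi j x := expR (s * a' j * x).
have mphi j : measurable_fun setT (phi j).
  apply: continuous_measurable_fun => x.
  apply: (@continuous_comp R R R (fun x : R => s * a' j * x) expR); last exact: continuous_expR.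
  by apply: cvgM; [exact: cvg_cst|exact: cvg_id].
have phi0 j x : 0 <= phi j x by exact: expR_ge0.
have L j := sato_tate_laplace (mX j) (lawX j) (sa' j).
pose c j := fine (\int[P]_w (phi j (X j w))%:E).
have Ec j : (\int[P]_w (phi j (X j w))%:E = (c j)%:E)%E.
  rewrite /c fineK// ge0_fin_numE; last by apply: integral_ge0 => x _; rewrite lee_fin.
  by apply: le_lt_trans (L j) _; rewrite ltry.
have cle j : c j <= expR (8 * s ^+ 2 * a' j ^+ 2).
  have : c j <= 1 + 8 * (s * a' j) ^+ 2 by rewrite -lee_fin -Ec; exact: L.
  by move/le_trans; apply; rewrite -mulrA -exprMn; exact: expR_ge1Dx.
have c0 j : 0 <= c j.
  by rewrite -lee_fin -Ec; apply: integral_ge0 => x _; rewrite lee_fin.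
set S := fun w => \sum_(j <- J) a j * X j w.
have expS w : \prod_(j <- J) phi j (X j w) = expR (s * S w).
  rewrite /S mulr_sumr expR_sum; apply: eq_big_seq => j jJ.
  by rewrite /phi /a' jJ mulrA.
have := cylinder_expectation_prod mphi phi0 Ec uHJ mB.
under eq_integral do rewrite expS.
move=> I.
have mS : measurable_fun setT S.
  apply: measurable_sum => j; apply: measurable_funM => //; exact: measurable_cst.
have mE : measurable [set w | l <= S w].
  rewrite -[X in measurable X]setTI (_ : [set w | _] = S @^-1` `[l, +oo[); first exact: mS.
  by apply/seteqP; split => w /=; rewrite in_itv/= andbT.
have mHE := measurableI _ _ mH mE.
have mexp : measurable_fun setT (fun w => expR (s * S w)).
  apply: (measurableT_comp (continuous_measurable_fun (@continuous_expR R))).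
  exact: measurable_funM.
have step : (P (cyl H B `&` [set w | (l <= S w)%R]) * (expR (s * l))%:E <=
             P (cyl H B) * (\prod_(j <- J) c j)%:E)%E.
  rewrite -I muleC -integral_cst//.
  apply: (@le_trans _ _ (\int[P]_(w in cyl H B `&` [set w | (l <= S w)%R]) (expR (s * S w))%:E)%E).
    apply: ge0_le_integral => //.
    - by move=> x _; rewrite lee_fin expR_ge0.
    - exact/measurable_EFinP/measurable_funTS.
    - by move=> w [_ /= h]; rewrite lee_fin ler_expR ler_wpM2l.
  apply: ge0_subset_integral => //.
  - exact/measurable_EFinP/measurable_funTS.
rewrite expRD expRN EFinM muleA lee_pdivlMr ?expR_gt0//.
apply: (le_trans step); apply: lee_wpmul2l; first exact: measure_ge0.
rewrite lee_fin mulr_sumr expR_sum big_seq [X in _ <= X]big_seq.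
apply: ler_prod => j jJ; rewrite c0/=.
by have := cle j; rewrite /a' jJ.
Qed.

End independence.

(** * Continuous functions on the unit interval *)

Section unit_interval.
Context (R : realType).
Implicit Types (u v : R -> R) (t y e : R).

Local Notation c01 u := ({within `[0%R, 1%R], continuous (u : R -> R)}).
Local Notation I01 u := (\int[lebesgue_measure]_(t in `[0%R, 1%R]) u t).

Lemma within01P u : c01 u <-> (forall t, 0 <= t <= 1 -> forall e, 0 < e ->
  exists2 r, 0 < r & forall y, 0 <= y <= 1 -> `|t - y| < r -> `|u t - u y| < e).
Proof.
split=> [/subspace_continuousP cu t t01 e e0|cu].
  have /cu/cvgrPdist_lt/(_ _ e0) : (`[0%R, 1%R]%classic : set R) t by rewrite /= in_itv.
  rewrite near_withinE => /nbhs_ballP[r /= r0 h].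
  by exists r => // y y01 ty; apply: h; rewrite /= ?in_itv.
apply/subspace_continuousP => t /=; rewrite in_itv/= => t01.
apply/cvgrPdist_lt => e e0; have [r r0 h] := cu _ t01 _ e0.
rewrite near_withinE; apply/nbhs_ballP; exists r => //= y ty.
by rewrite in_itv/= => y01; exact: h.
Qed.

Lemma within01_uniform u : c01 u -> forall e, 0 < e ->
  exists2 r, 0 < r & forall t y, 0 <= t <= 1 -> 0 <= y <= 1 ->
    `|t - y| < r -> `|u t - u y| < e.
Proof.
move=> /within01P cu e e0.
have cov := (near_covering_withinP _).2 ((compact_near_coveringP _).1 (@segment_compact R 0 1)).
pose Q (r t : R) := forall y, 0 <= y <= 1 -> `|t - y| < r -> `|u t - u y| < e.
have H : \forall r \near 0^'+, `[0%R, 1%R]%classic `<=` Q r.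
  apply: cov => x xI; have x01 : 0 <= x <= 1 by move: xI; rewrite /= ?in_itv.
  have e20 : 0 < e / 2 by rewrite divr_gt0.
  have [r r0 h] := cu _ x01 _ e20.
  have r20 : 0 < r / 2 by rewrite divr_gt0.
  (* Half of the continuity radius at [x] goes to the neighbourhood of [x], the other half to the
     uniform modulus. *)
  exists (ball x (r / 2), [set z | z < r / 2]).
    by split; [exact: nbhsx_ballx|exact: nbhs_right_lt].
  move=> [x' z] /= [xx' zr] x'I y y01 x'y.
  have x'01 : 0 <= x' <= 1 by move: x'I; rewrite /= ?in_itv.
  have h1 : `|u x - u x'| < e / 2 by apply: h => //; apply: lt_trans xx' _; lra.
  have h2 : `|u x - u y| < e / 2.
    apply: h => //; apply: le_lt_trans (ler_distD x' _ _) _.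
    by move: xx'; rewrite /ball/= => xx'; lra.
  apply: le_lt_trans (ler_distD (u x) _ _) _; rewrite (distrC (u x')); lra.
have : \forall r \near 0^'+, 0 < r /\ forall t, 0 <= t <= 1 -> Q r t.
  near=> r; split; first by near: r; exact: nbhs_right_gt.
  move=> t t01; move: t t01; near: r; apply: filterS H => r hr t t01.
  by apply: hr; rewrite /= ?in_itv.
by move=> /filter_ex[r [r0 hr]]; exists r => // t y t01; exact: hr.
Unshelve. all: by end_near. Qed.

Lemma within01_bounded u : c01 u ->
  exists2 M, 0 < M & forall t, 0 <= t <= 1 -> `|u t| <= M.
Proof.
move=> cu.
have [a _ ha] := EVT_max ler01 cu.
have [b _ hb] := EVT_min ler01 cu.
exists (`|u a| + `|u b| + 1) => [|t t01].
  by rewrite ltr_wpDl// addr_ge0.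
have tI : t \in `[0%R, 1%R] by rewrite in_itv.
have := ha _ tI; have := hb _ tI; have := ler_norm (u a); have := ler_norm (- u b).
rewrite normrN ler_norml => h1 h2 h3 h4.
have := normr_ge0 (u a); have := normr_ge0 (u b) => h5 h6.
by apply/andP; split; lra.
Qed.

Lemma within01_const (c : R) : c01 (fun=> c).
Proof. by apply: continuous_subspaceT => x; exact: cvg_cst. Qed.

Lemma within01D u v : c01 u -> c01 v -> c01 (fun t => u t + v t).
Proof. by move=> cu cv x; apply: cvgD; [exact: cu|exact: cv]. Qed.

Lemma within01B u v : c01 u -> c01 v -> c01 (fun t => u t - v t).
Proof. by move=> cu cv x; apply: cvgB; [exact: cu|exact: cv]. Qed.

Lemma within01M u v : c01 u -> c01 v -> c01 (fun t => u t * v t).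
Proof. by move=> cu cv x; apply: cvgM; [exact: cu|exact: cv]. Qed.

Lemma within01_sum (s : seq nat) (F : nat -> R -> R) :
  (forall n, c01 (F n)) -> c01 (fun t => \sum_(n <- s) F n t).
Proof.
move=> cF; elim: s => [|n s IH].
  rewrite (_ : (fun t => _) = (fun=> 0)); first exact: within01_const.
  by apply/funext => t; rewrite big_nil.
rewrite (_ : (fun t => _) = (fun t => F n t + \sum_(n <- s) F n t)).
  exact: within01D.
by apply/funext => t; rewrite big_cons.
Qed.

Lemma within01_integrable u : c01 u ->
  (@lebesgue_measure R).-integrable `[0%R, 1%R] (EFin \o u).
Proof.
by move=> cu; apply: continuous_compact_integrable => //; exact: segment_compact.
Qed.

Lemma Rintegral01D u v : c01 u -> c01 v -> I01 (fun t => u t + v t) = I01 u + I01 v.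
Proof. by move=> cu cv; rewrite RintegralD//; exact: within01_integrable. Qed.

Lemma Rintegral01B u v : c01 u -> c01 v -> I01 (fun t => u t - v t) = I01 u - I01 v.
Proof. by move=> cu cv; rewrite RintegralB//; exact: within01_integrable. Qed.

Lemma Rintegral01Z (c : R) u : c01 u -> I01 (fun t => c * u t) = c * I01 u.
Proof. by move=> cu; rewrite RintegralZl//; exact: within01_integrable. Qed.

Lemma Rintegral01_const (c : R) : I01 (fun=> c) = c.
Proof.
by rewrite Rintegral_cst//= lebesgue_measure_itv/= lte_fin ltr01 sube0 mulr1.
Qed.

Lemma Rintegral01_sum (s : seq nat) (F : nat -> R -> R) :
  (forall n, c01 (F n)) ->
  I01 (fun t => \sum_(n <- s) F n t) = \sum_(n <- s) I01 (F n).
Proof.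
move=> cF; elim: s => [|n s IH].
  by under eq_Rintegral do rewrite big_nil; rewrite Rintegral01_const big_nil.
under eq_Rintegral do rewrite big_cons.
rewrite big_cons -IH Rintegral01D//; exact: within01_sum.
Qed.

Lemma Rintegral01_le u v : c01 u -> c01 v ->
  (forall t, 0 <= t <= 1 -> u t <= v t) -> I01 u <= I01 v.
Proof.
move=> cu cv uv; apply: le_Rintegral => //; exact: within01_integrable.
Qed.

Lemma Rintegral01_norm_le u v : c01 u -> c01 v ->
  (forall t, 0 <= t <= 1 -> `|u t| <= v t) -> `|I01 u| <= I01 v.
Proof.
move=> cu cv uv.
have E : - I01 u = I01 (fun t => (-1) * u t) by rewrite Rintegral01Z// mulN1r.
rewrite ler_norml lerNl E; apply/andP; split; apply: Rintegral01_le => //.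
- by apply: within01M => //; exact: within01_const.
- by move=> t /uv; rewrite ler_norml => /andP[h _]; lra.
- by move=> t /uv; rewrite ler_norml => /andP[_ h]; lra.
Qed.

(** * Fejer's theorem *)

Definition phase (n : nat) t := 2 * pi * (n%:R * t).
Definition cosn (n : nat) t : R := cos (phase n t).
Definition sinn (n : nat) t : R := sin (phase n t).

Lemma cosn_continuous n : continuous (cosn n).
Proof.
move=> x; apply: (@continuous_comp R R R (phase n) cos); last exact: continuous_cos.
by apply: cvgM; [exact: cvg_cst|apply: cvgM; [exact: cvg_cst|exact: cvg_id]].
Qed.

Lemma sinn_continuous n : continuous (sinn n).
Proof.
move=> x; apply: (@continuous_comp R R R (phase n) sin); last exact: continuous_sin.
by apply: cvgM; [exact: cvg_cst|apply: cvgM; [exact: cvg_cst|exact: cvg_id]].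
Qed.

Lemma within01_cosn n : c01 (cosn n).
Proof. by apply: continuous_subspaceT; exact: cosn_continuous. Qed.

Lemma within01_sinn n : c01 (sinn n).
Proof. by apply: continuous_subspaceT; exact: sinn_continuous. Qed.

Lemma phase0 n : phase n 0 = 0.
Proof. by rewrite /phase !mulr0. Qed.

Lemma cosn0 n : cosn n 0 = 1. Proof. by rewrite /cosn phase0 cos0. Qed.

Lemma cosn0E t : cosn 0 t = 1.
Proof. by rewrite /cosn /phase mul0r mulr0 cos0. Qed.

Lemma sinn0 n : sinn n 0 = 0. Proof. by rewrite /sinn phase0 sin0. Qed.

Lemma phase1 n : phase n 1 = 0 + (pi *+ 2) *+ n.
Proof. by rewrite /phase mulr1 add0r -(mulr_natr (pi *+ 2)) -(mulr_natl pi). Qed.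

Lemma cosn1 n : cosn n 1 = 1.
Proof. by rewrite /cosn phase1 (periodicn (@cosD2pi R)) cos0. Qed.

Lemma sinn1 n : sinn n 1 = 0.
Proof. by rewrite /sinn phase1 (periodicn (@sinD2pi R)) sin0. Qed.

Lemma is_derive_phase n t : is_derive t 1 (phase n) (2 * pi * n%:R).
Proof.
have -> : phase n = (2 * pi * n%:R) \*: id by apply/funext => y; rewrite /phase /= mulrA.
by have := is_deriveZ (2 * pi * n%:R) (is_derive_id t 1); rewrite scaler1.
Qed.

Lemma is_derive_cosn n t : is_derive t 1 (cosn n) (- (2 * pi * n%:R) * sinn n t).
Proof.
apply: is_derive_eq (is_derive1_comp (is_derive_cos (phase n t)) (is_derive_phase n t)) _.
by rewrite /sinn; ring.
Qed.

Lemma is_derive_sinn n t : is_derive t 1 (sinn n) ((2 * pi * n%:R) * cosn n t).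
Proof.
apply: is_derive_eq (is_derive1_comp (is_derive_sin (phase n t)) (is_derive_phase n t)) _.
by rewrite /cosn; ring.
Qed.

Lemma freq_gt0 n : (0 < n)%N -> 0 < 2 * pi * n%:R :> R.
Proof. by move=> n0; rewrite !mulr_gt0 ?pi_gt0// ltr0n. Qed.

Lemma Rintegral01_derive u F : c01 u -> (forall t, is_derive t 1 F (u t)) ->
  I01 u = F 1 - F 0.
Proof.
move=> cu dF.
have cF : continuous F by move=> t; apply: differentiable_continuous; apply/derivable1_diffP.
rewrite /Rintegral (@continuous_FTC2 R u F 0 1)//.
  split => [t _| |].
  - exact: ex_derive.
  - exact/cvg_at_right_filter/cF.
  - exact/cvg_at_left_filter/cF.
by move=> t _; rewrite derive1E; exact: derive_val.
Qed.

Lemma Rintegral01_cosn n : (0 < n)%N -> I01 (cosn n) = 0.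
Proof.
move=> n0; have c : c01 (fun t => 2 * pi * n%:R * cosn n t).
  by apply: within01M; [exact: within01_const|exact: within01_cosn].
have := Rintegral01_derive c (is_derive_sinn n).
rewrite sinn1 sinn0 subrr Rintegral01Z; last exact: within01_cosn.
by move=> /eqP; rewrite mulf_eq0 (gt_eqF (freq_gt0 n0)) => /eqP.
Qed.

Lemma Rintegral01_sinn n : (0 < n)%N -> I01 (sinn n) = 0.
Proof.
move=> n0; have c : c01 (fun t => - (2 * pi * n%:R) * sinn n t).
  by apply: within01M; [exact: within01_const|exact: within01_sinn].
have := Rintegral01_derive c (is_derive_cosn n).
rewrite cosn1 cosn0 subrr Rintegral01Z; last exact: within01_sinn.
by move=> /eqP; rewrite mulf_eq0 oppr_eq0 (gt_eqF (freq_gt0 n0)) => /eqP.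
Qed.

(** [Cs] and [Ss] are the real and imaginary parts of D = sum of e^(ikx) over k < N, and [fejer] is
    |D|^2, that is, N times the usual Fejer kernel. *)
Let Cs N (x : R) := \sum_(0 <= k < N) cos (k%:R * x).
Let Ss N (x : R) := \sum_(0 <= k < N) sin (k%:R * x).
Let fejer N (x : R) := Cs N x ^+ 2 + Ss N x ^+ 2.

Lemma fejer_ge0 N x : 0 <= fejer N x.
Proof. by rewrite addr_ge0// sqr_ge0. Qed.

(** Real and imaginary parts of (e^(ix) - 1) D = e^(iNx) - 1. *)
Lemma dirichlet_telescope N x :
  Cs N x * (cos x - 1) - Ss N x * sin x = cos (N%:R * x) - 1 /\
  Ss N x * (cos x - 1) + Cs N x * sin x = sin (N%:R * x).
Proof.
elim: N => [|N [IH1 IH2]].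
  by rewrite /Cs /Ss !big_nil !mul0r cos0 sin0 !subrr addr0.
rewrite /Cs /Ss !big_nat_recr//= -/(Cs N x) -/(Ss N x).
rewrite -(natr1 N) [(N%:R + 1) * x]mulrDl mul1r cosD sinD.
split; lra.
Qed.

(** Squared moduli in the telescoped identity: |e^(ix) - 1|^2 = 2 (1 - cos x) and |e^(iNx) - 1|^2 <=
    4. This form of the decay away from 0 needs no division. *)
Lemma fejer_bound N x : fejer N x * (1 - cos x) <= 2.
Proof.
have [h1 h2] := dirichlet_telescope N x.
have c1 := cos2Dsin2 x; have c2 := cos2Dsin2 (N%:R * x).
have c3 := cos_geN1 (N%:R * x).
have : (cos (N%:R * x) - 1) ^+ 2 + sin (N%:R * x) ^+ 2 = fejer N x * (2 * (1 - cos x)).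
  rewrite -h1 -h2 /fejer.
  have -> : 2 * (1 - cos x) = (cos x - 1) ^+ 2 + sin x ^+ 2 by lra.
  by ring.
by lra.
Qed.

Lemma fejer_expand N x :
  fejer N x = N%:R + \sum_(1 <= n < N) 2 * (N%:R - n%:R) * cos (n%:R * x).
Proof.
elim: N => [|N IH].
  by rewrite /fejer /Cs /Ss !big_nil expr0n/= !addr0.
(* Adding the term z = e^(iNx) changes |D|^2 into |D|^2 + 2 Re(D conj z) + 1. The left side is this
   real part, a sum of cos((N - k) x) that is reindexed by n = N - k. *)
have E : Cs N x * cos (N%:R * x) + Ss N x * sin (N%:R * x) =
    \sum_(1 <= n < N.+1) cos (n%:R * x).
  rewrite /Cs /Ss !mulr_suml -big_split /= big_add1/= big_nat_rev/=.
  rewrite big_nat [in RHS]big_nat; apply: eq_bigr => k /= kN.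
  rewrite -[LHS]addrC addrC -cosB -cosN opprB -mulrBl; congr (cos (_ * x)).
  by rewrite add0n -natrB; [congr _%:R; lia|lia].
have -> : fejer N.+1 x = fejer N x + 2 * (\sum_(1 <= n < N.+1) cos (n%:R * x)) + 1.
  rewrite -E /fejer /Cs /Ss !big_nat_recr//= -/(Cs N x) -/(Ss N x).
  have := cos2Dsin2 (N%:R * x); lra.
rewrite IH -(natr1 N).
case: N {IH E} => [|N]; first by rewrite !big_geq// !mulr0 !addr0 add0r.
rewrite !(@big_nat_recr _ _ _ N.+1)//= mulrDr mulr_sumr.
rewrite [in RHS](eq_bigr (fun n => 2 * (N.+1%:R - n%:R) * cos (n%:R * x) +
   2 * cos (n%:R * x))); last by move=> i _; ring.
by rewrite big_split/=; ring.
Qed.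

Definition cos_coef u n : R := I01 (fun t => u t * cosn n t).
Definition sin_coef u n : R := I01 (fun t => u t * sinn n t).

(** Real form of the sum of (1 - |n| / N) u^(n) e(nt) over |n| < N; the factor 2 comes from grouping
    n with -n. *)
Definition fejer_mean (N : nat) u t : R := cos_coef u 0 +
  \sum_(1 <= n < N) 2 * (1 - n%:R / N%:R) *
    (cos_coef u n * cosn n t + sin_coef u n * sinn n t).

Lemma fejer_shift N t y : fejer N (2 * pi * (t - y)) = N%:R +
  \sum_(1 <= n < N) 2 * (N%:R - n%:R) * (cosn n t * cosn n y + sinn n t * sinn n y).
Proof.
rewrite fejer_expand; congr (_ + _); apply: eq_bigr => n _; congr (_ * _).
by rewrite -cosB; congr cos; rewrite /phase; ring.
Qed.

Lemma fejer_convolution N u t : c01 u -> (0 < N)%N ->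
  I01 (fun y => u y * fejer N (2 * pi * (t - y))) = N%:R * fejer_mean N u t.
Proof.
move=> cu N0; have N0' : N%:R != 0 :> R by rewrite pnatr_eq0 -lt0n.
have cc n : c01 (fun y => u y * cosn n y).
  by apply: within01M => //; exact: within01_cosn.
have cs n : c01 (fun y => u y * sinn n y).
  by apply: within01M => //; exact: within01_sinn.
have ccc n (k : R) : c01 (fun y => k * (u y * cosn n y)).
  by apply: within01M => //; exact: within01_const.
have css n (k : R) : c01 (fun y => k * (u y * sinn n y)).
  by apply: within01M => //; exact: within01_const.
have E y : u y * fejer N (2 * pi * (t - y)) = N%:R * (u y * cosn 0 y) +
    \sum_(1 <= n < N) ((2 * (N%:R - n%:R) * cosn n t) * (u y * cosn n y) +
      (2 * (N%:R - n%:R) * sinn n t) * (u y * sinn n y)).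
  rewrite fejer_shift mulrDr mulr_sumr cosn0E; congr (_ + _).
    by ring.
  by apply: eq_bigr => n _; ring.
under eq_Rintegral do rewrite E.
have cF n : c01 (fun y => 2 * (N%:R - n%:R) * cosn n t * (u y * cosn n y) +
      2 * (N%:R - n%:R) * sinn n t * (u y * sinn n y)).
  exact: within01D.
rewrite Rintegral01D//; last exact: within01_sum.
rewrite Rintegral01Z// Rintegral01_sum// /fejer_mean mulrDr mulr_sumr.
congr (_ + _); apply: eq_bigr => n _.
rewrite Rintegral01D// !Rintegral01Z// -/(cos_coef u n) -/(sin_coef u n).
by field.
Qed.

Lemma fejer_mass N t : (0 < N)%N -> I01 (fun y => fejer N (2 * pi * (t - y))) = N%:R.
Proof.
move=> N0; have := @fejer_convolution N (fun=> 1) t (@within01_const 1) N0.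
under eq_Rintegral do rewrite mul1r.
have one : cos_coef (fun=> 1) 0 = 1.
  rewrite /cos_coef; under eq_Rintegral do rewrite cosn0E mul1r.
  exact: Rintegral01_const.
move=> ->; rewrite /fejer_mean one /cos_coef /sin_coef.
rewrite big_nat big1 ?addr0 ?mulr1// => n /andP[n0 _].
under eq_Rintegral do rewrite mul1r.
rewrite Rintegral01_cosn//.
under eq_Rintegral do rewrite mul1r.
by rewrite Rintegral01_sinn// !mul0r addr0 mulr0.
Qed.

(** The modulus of continuity is written with 1 - cos, the quantity that [fejer_bound] controls
    against the kernel. Near the diagonal uniform continuity suffices; elsewhere [M] outweighs twice
    the bound of [u]. *)
Lemma periodic_modulus u : c01 u -> u 0 = u 1 -> forall e, 0 < e ->
  exists2 M, 0 <= M & forall t y, 0 <= t <= 1 -> 0 <= y <= 1 ->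
    `|u y - u t| <= e + M * (1 - cos (2 * pi * (t - y))).
Proof.
move=> cu u01 e e0.
have [B B0 hB] := within01_bounded cu.
have e20 : 0 < e / 2 by rewrite divr_gt0.
have [r r0 hr] := within01_uniform cu e20.
pose r' := Num.min r (2^-1).
have r'0 : 0 < r' by rewrite lt_min r0 invr_gt0 ltr0n.
have r'r : r' <= r by rewrite ge_min lexx.
have r'h : r' <= 2^-1 by rewrite ge_min lexx orbT.
have cc : c01 (fun t => 1 - cos (2 * pi * t)).
  rewrite (_ : (fun t => _) = (fun t => 1 - cosn 1 t)).
    by apply: within01B; [exact: within01_const|exact: within01_cosn].
  by apply/funext => t; rewrite /cosn /phase mul1r.
have ccr : {within `[r', 1 - r'], continuous (fun t => 1 - cos (2 * pi * t))}.
  apply: continuous_subspaceW cc => x /=; rewrite !in_itv/= => /andP[h1 h2].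
  by apply/andP; split; lra.
have rr : r' <= 1 - r' by lra.
have [c cI hc] := EVT_min rr ccr.
(* [c] minimizes 1 - cos(2 pi t) = 2 sin^2(pi t) over a segment inside ]0, 1[, where the sine is
   positive. *)
have c0 : 0 < 1 - cos (2 * pi * c).
  have -> : 1 - cos (2 * pi * c) = 2 * sin (pi * c) ^+ 2.
    have -> : 2 * pi * c = (pi * c) *+ 2 by rewrite mulr2n; ring.
    by rewrite cos_mulr2n sin2cos2 mulr2n; ring.
  rewrite mulr_gt0// exprn_gt0// sin_gt0_pi//.
  move: cI; rewrite in_itv/= => /andP[h1 h2]; have p0 := @pi_gt0 R.
  by apply/andP; split; nra.
exists (2 * B / (1 - cos (2 * pi * c))); first by rewrite divr_ge0 ?mulr_ge0// ltW.
move=> t y.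
have key : forall a b : R, a <= b -> 0 <= a <= 1 -> 0 <= b <= 1 ->
    `|u a - u b| <= e + 2 * B / (1 - cos (2 * pi * c)) * (1 - cos (2 * pi * (b - a))).
  move=> a b ab a01 b01.
  have P0 : 0 <= 2 * B / (1 - cos (2 * pi * c)) * (1 - cos (2 * pi * (b - a))).
    rewrite mulr_ge0 ?divr_ge0 ?mulr_ge0// ?ltW// subr_ge0; exact: cos_le1.
  have [h1|h1] := ltP (b - a) r'.
    apply: le_trans (_ : e / 2 <= _); last by lra.
    apply/ltW/hr => //; rewrite distrC ger0_norm; lra.
  (* Here [a] is close to 0 and [b] close to 1, two points at which [u] takes the same value. *)
  have [h2|h2] := ltP (1 - r') (b - a).
    move: (a01) (b01) => /andP[a0 a1] /andP[b0 b1].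
    have k1 : `|u 0 - u a| < e / 2.
      by apply: hr => //; rewrite ?lexx ?ler01// sub0r normrN ger0_norm//; lra.
    have k2 : `|u 1 - u b| < e / 2.
      by apply: hr => //; rewrite ?lexx ?ler01// ger0_norm//; lra.
    apply: le_trans (ler_distD (u 0) _ _) _.
    by rewrite (distrC (u a)) {2}u01; lra.
  have := hc (b - a); rewrite in_itv/= h1 h2 => /(_ isT) h3.
  apply: le_trans (_ : 2 * B <= _).
    by apply: le_trans (ler_normB _ _) _; have := hB _ a01; have := hB _ b01; lra.
  apply: ler_wpDl; first exact: ltW.
  rewrite [X in _ <= X]mulrAC ler_pdivlMr//.
  by apply: ler_wpM2l; [rewrite mulr_ge0// ltW|exact: h3].
move=> t01 y01; have [yt|/ltW ty] := leP y t; first exact: key.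
rewrite distrC; have := key _ _ ty t01 y01.
by rewrite -(opprB t y) mulrN cosN.
Qed.

(** Against the kernel of mass N, the part e/2 of the modulus gives N e / 2 and the cosine part at
    most 2 M, so the error is at most e/2 + 2 M / N. *)
Lemma fejer_theorem u : c01 u -> u 0 = u 1 -> forall e, 0 < e ->
  exists N0, forall N, (N0 <= N)%N -> (0 < N)%N ->
    forall t, 0 <= t <= 1 -> `|fejer_mean N u t - u t| <= e.
Proof.
move=> cu u01 e e0.
have e20 : 0 < e / 2 by rewrite divr_gt0.
have [M M0 hM] := periodic_modulus cu u01 e20.
exists (Num.truncn (4 * M / e)).+1 => N hN N0 t t01.
have NR : 0 < N%:R :> R by rewrite ltr0n.
have MN : 2 * M <= N%:R * (e / 2).
  have : 4 * M / e < N%:R by apply: lt_le_trans (truncnS_gt _) _; rewrite ler_nat.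
  by rewrite ltr_pdivrMr//; lra.
have cfej : c01 (fun y => fejer N (2 * pi * (t - y))).
  rewrite (_ : (fun y => _) = (fun y => N%:R + \sum_(1 <= n < N) 2 * (N%:R - n%:R) *
     (cosn n t * cosn n y + sinn n t * sinn n y))); last first.
    by apply/funext => y; exact: fejer_shift.
  apply: within01D; first exact: within01_const.
  apply: within01_sum => n; apply: within01M; first exact: within01_const.
  by apply: within01D; apply: within01M; [exact: within01_const|exact: within01_cosn
    |exact: within01_const|exact: within01_sinn].
rewrite -(ler_pM2l NR) -[X in X * _ <= _](gtr0_norm NR) -normrM mulrBr.
have cuf : c01 (fun y => u y * fejer N (2 * pi * (t - y))) by exact: within01M.
have ctf : c01 (fun y => u t * fejer N (2 * pi * (t - y))).
  by apply: within01M => //; exact: within01_const.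
have cef : c01 (fun y => (e / 2) * fejer N (2 * pi * (t - y))).
  by apply: within01M => //; exact: within01_const.
have E2 : N%:R * u t = I01 (fun y => u t * fejer N (2 * pi * (t - y))).
  by rewrite Rintegral01Z// fejer_mass// mulrC.
rewrite -fejer_convolution// E2 -Rintegral01B//.
apply: le_trans (_ : I01 (fun y => (e / 2) * fejer N (2 * pi * (t - y)) + 2 * M) <= _).
  apply: Rintegral01_norm_le.
  - exact: within01B.
  - by apply: within01D => //; exact: within01_const.
  move=> y y01; rewrite -mulrBl normrM [X in _ * X]ger0_norm ?fejer_ge0//.
  have h1 := hM _ _ t01 y01; have h2 := fejer_bound N (2 * pi * (t - y)).
  have h3 := fejer_ge0 N (2 * pi * (t - y)).
  apply: le_trans (ler_wpM2r h3 h1) _.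
  rewrite mulrDl lerD2l -(mulrA M) [X in _ <= X]mulrC ler_wpM2l//.
  by rewrite mulrC.
rewrite Rintegral01D//; last exact: within01_const.
by rewrite Rintegral01_const Rintegral01Z// fejer_mass//; lra.
Qed.

End unit_interval.

(** * Uniform limits and measurability *)

Section complex_abs.
Context (R : realType).
Implicit Types z : R[i].

(** The norm of [R[i]] takes its values in [R[i]]; this real-valued modulus allows real arithmetic
    and real continuity arguments. *)
Definition cabs z : R := Num.sqrt (complex.Re z ^+ 2 + complex.Im z ^+ 2).

Lemma normc_cabs z : `|z| = (cabs z)%:C.
Proof. exact: normc_def. Qed.

Lemma cabsD z1 z2 : cabs (z1 + z2) <= cabs z1 + cabs z2.
Proof. by rewrite -lecR rmorphD/= -!normc_cabs ler_normD. Qed.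

Lemma cabs_distC z1 z2 : cabs (z1 - z2) = cabs (z2 - z1).
Proof. by apply: complexI; rewrite -!normc_cabs distrC. Qed.

Lemma cabs_distD z3 z1 z2 : cabs (z1 - z2) <= cabs (z1 - z3) + cabs (z3 - z2).
Proof. by rewrite -[z1 - z2](subrKA z3); exact: cabsD. Qed.

Lemma cabs_dist_dist z1 z2 z3 : `|cabs (z1 - z3) - cabs (z2 - z3)| <= cabs (z1 - z2).
Proof.
have h1 := cabs_distD z2 z1 z3; have h2 := cabs_distD z1 z2 z3.
by rewrite ler_norml; rewrite (cabs_distC z2 z1) in h2; apply/andP; split; lra.
Qed.

Lemma Re_le_cabs z : `|complex.Re z| <= cabs z.
Proof. by rewrite -sqrtr_sqr ler_wsqrtr// lerDl sqr_ge0. Qed.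

Lemma Im_le_cabs z : `|complex.Im z| <= cabs z.
Proof. by rewrite -sqrtr_sqr ler_wsqrtr// lerDr sqr_ge0. Qed.

Lemma cabs_le z : cabs z <= `|complex.Re z| + `|complex.Im z|.
Proof.
rewrite -[X in _ <= X]ger0_norm ?addr_ge0// -sqrtr_sqr ler_wsqrtr//.
rewrite sqrrD !real_normK ?num_real//.
by rewrite -addrA lerD2l lerDr mulrn_wge0// mulr_ge0.
Qed.

Lemma Re_sub z1 z2 : complex.Re (z1 - z2) = complex.Re z1 - complex.Re z2.
Proof. by case: z1 z2 => [a b] [c d]. Qed.

Lemma Im_sub z1 z2 : complex.Im (z1 - z2) = complex.Im z1 - complex.Im z2.
Proof. by case: z1 z2 => [a b] [c d]. Qed.

End complex_abs.

Section uniform_limits.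
Context (R : realType).
Local Notation c01 u := ({within `[0%R, 1%R], continuous (u : R -> R)}).
Implicit Types (u v : R -> R) (t e : R).

Lemma within01_approx u : (forall e, 0 < e -> exists2 v, c01 v &
    forall t, 0 <= t <= 1 -> `|u t - v t| < e) -> c01 u.
Proof.
move=> h; apply/within01P => t t01 e e0.
have e30 : 0 < e / 3 by rewrite divr_gt0.
have [v /within01P cv uv] := h _ e30.
have [r r0 hr] := cv _ t01 _ e30.
exists r => // y y01 /(hr _ y01) vty.
have h1 := uv _ t01; have h2 := uv _ y01.
apply: le_lt_trans (ler_distD (v t) _ _) _.
have := ler_distD (v y) (v t) (u y); rewrite (distrC (v y) (u y)); lra.
Qed.

Lemma within01_cabs (F G : R -> R[i]) :
  c01 (fun t => complex.Re (F t)) -> c01 (fun t => complex.Im (F t)) ->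
  c01 (fun t => complex.Re (G t)) -> c01 (fun t => complex.Im (G t)) ->
  c01 (fun t => cabs (F t - G t)).
Proof.
move=> F1 F2 G1 G2.
have c : c01 (fun t => (complex.Re (F t) - complex.Re (G t)) * (complex.Re (F t) - complex.Re (G t)) +
   (complex.Im (F t) - complex.Im (G t)) * (complex.Im (F t) - complex.Im (G t))).
  by apply: within01D; apply: within01M; apply: within01B.
rewrite (_ : (fun t => cabs _) = Num.sqrt \o (fun t =>
  (complex.Re (F t) - complex.Re (G t)) * (complex.Re (F t) - complex.Re (G t)) +
   (complex.Im (F t) - complex.Im (G t)) * (complex.Im (F t) - complex.Im (G t)))).
  by move=> x; exact: continuous_comp (c x) (@sqrt_continuous R _).
by apply/funext => t; rewrite /cabs Re_sub Im_sub.
Qed.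

Lemma inv_succ_lt e : 0 < e -> exists p : nat, p.+1%:R^-1 < e.
Proof.
move=> e0; exists (Num.truncn e^-1); rewrite -[X in _ < X]invrK ltf_pV2 ?posrE ?invr_gt0//.
exact: truncnS_gt.
Qed.

Lemma real_cauchy_cvg (a : nat -> R) :
  (forall p : nat, exists N0 : nat, forall N M, (N0 <= N)%N -> (N0 <= M)%N ->
    `|a N - a M| <= p.+1%:R^-1) -> cvgn a.
Proof.
move=> h; apply/cauchy_cvgP/cauchy_exP => e e0.
have [p hp] := inv_succ_lt e0.
have [N0 hN] := h p; exists (a N0); exists N0 => //= M NM.
by rewrite /ball/=; apply: le_lt_trans hp; exact: hN.
Qed.

Lemma lim_dist_le (a : nat -> R) c N0 : cvgn a ->
  (forall N M, (N0 <= N)%N -> (N0 <= M)%N -> `|a N - a M| <= c) ->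
  forall N, (N0 <= N)%N -> `|a N - limn a| <= c.
Proof.
move=> ca h N N0N; rewrite distrC; apply/ler_addgt0Pr => e e0.
move/cvgrPdist_lt : ca => /(_ _ e0)[M0 _ hM].
have := hM (maxn M0 N0) (leq_maxl _ _) => /= h1.
have := h (maxn M0 N0) N (leq_maxr _ _) N0N => h2.
by apply: le_trans (ler_distD (a (maxn M0 N0)) _ _) _; lra.
Qed.

(** This removes the quantifier over [k]: the right side has, apart from [t], only natural numbers
    as variables. The strict bound defining the ball becomes a closed one with a margin 1/(p+1),
    stable under limits. *)
Lemma uniform_limit_sup_ballP (F : nat -> R -> R[i]) (f : R -> R[i]) (eps : R) :
  (forall N, c01 (fun t => complex.Re (F N t))) -> (forall N, c01 (fun t => complex.Im (F N t))) ->
  c01 (fun t => complex.Re (f t)) -> c01 (fun t => complex.Im (f t)) ->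
  (exists k : R -> R[i], (forall e, 0 < e -> exists N0, forall N, (N0 <= N)%N ->
      forall t, t \in `[0%R, 1%R] -> `|F N t - k t| < e%:C) /\ sup_ball f eps k) <->
  (forall p : nat, exists N0, forall N M, (N0 <= N)%N -> (N0 <= M)%N ->
      forall t, 0 <= t <= 1 -> cabs (F N t - F M t) <= p.+1%:R^-1) /\
  (exists p N0 : nat, forall N, (N0 <= N)%N -> forall t, 0 <= t <= 1 ->
      cabs (F N t - f t) <= eps - p.+1%:R^-1).
Proof.
move=> cF1 cF2 cf1 cf2; split=> [[k [Fk kf]]|[hc [p [N0 hf]]]].
  have {}Fk e : 0 < e -> exists N0, forall N, (N0 <= N)%N ->
      forall t, 0 <= t <= 1 -> cabs (F N t - k t) < e.
    move=> /Fk[N0 h]; exists N0 => N /h {}h t t01.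
    by rewrite -ltcR -normc_cabs h// in_itv.
  split=> [p|].
    have : 0 < p.+1%:R^-1 :> R by rewrite invr_gt0.
    move: (p.+1%:R^-1) => e e0; have e20 : 0 < e / 2 by rewrite divr_gt0.
    have [N0 h] := Fk _ e20; exists N0 => N M hN hM t t01.
    apply: le_trans (cabs_distD (k t) _ _) _; rewrite (cabs_distC (k t)).
    by have := h _ hN _ t01; have := h _ hM _ t01; lra.
  (* [k] is not assumed continuous, but the distance to [f] is a uniform limit of continuous
     functions, so its maximum is attained and lies strictly below [eps]. *)
  have cu : c01 (fun t => cabs (k t - f t)).
    apply: within01_approx => e e0; have [N h] := Fk _ e0.
    exists (fun t => cabs (F N t - f t)); first exact: within01_cabs.
    move=> t t01; apply: le_lt_trans (cabs_dist_dist _ _ _) _.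
    by rewrite cabs_distC h.
  have [c cI hc] := EVT_max ler01 cu.
  have := kf _ cI; rewrite normc_cabs ltcR => kfc.
  (* Half of the gap pays for 1/(p+1), the other half for the distance from [F N] to [k]. *)
  have d0 : 0 < (eps - cabs (k c - f c)) / 2 by lra.
  have [p hp] := inv_succ_lt d0; have [N0 h] := Fk _ d0.
  exists p, N0 => N hN t t01; move: (p.+1%:R^-1) hp => e hp.
  apply: le_trans (cabs_distD (k t) _ _) _.
  have tI : t \in `[0%R, 1%R] by rewrite in_itv.
  by have := h _ hN _ t01; have /= := hc _ tI; lra.
(* The pointwise limit; the factor 2 below counts one Cauchy bound for the real part and one for the
   imaginary part. *)
pose k t := limn (fun N => complex.Re (F N t)) +i* limn (fun N => complex.Im (F N t)).
have Fk q : exists N0, forall N, (N0 <= N)%N ->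
    forall t, 0 <= t <= 1 -> cabs (F N t - k t) <= 2 * q.+1%:R^-1.
  have [N1 hN] := hc q; exists N1 => N N1N t t01.
  have cR : cvgn (fun N => complex.Re (F N t)).
    apply: real_cauchy_cvg => r; have [N2 h2] := hc r; exists N2 => N' M' hN' hM'.
    by rewrite -Re_sub; apply: le_trans (Re_le_cabs _) _; exact: h2.
  have cI : cvgn (fun N => complex.Im (F N t)).
    apply: real_cauchy_cvg => r; have [N2 h2] := hc r; exists N2 => N' M' hN' hM'.
    by rewrite -Im_sub; apply: le_trans (Im_le_cabs _) _; exact: h2.
  apply: le_trans (cabs_le _) _; rewrite Re_sub Im_sub mulrDl mul1r.
  apply: lerD.
    apply: (lim_dist_le cR) N1N => N' M' hN' hM'.
    by rewrite -Re_sub; apply: le_trans (Re_le_cabs _) _; exact: hN.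
  apply: (lim_dist_le cI) N1N => N' M' hN' hM'.
  by rewrite -Im_sub; apply: le_trans (Im_le_cabs _) _; exact: hN.
have {}Fk e : 0 < e -> exists N0, forall N, (N0 <= N)%N ->
      forall t, 0 <= t <= 1 -> cabs (F N t - k t) < e.
  move=> e0; have e20 : 0 < e / 2 by rewrite divr_gt0.
  have [q hq] := inv_succ_lt e20; have [N1 h] := Fk q.
  by move: (q.+1%:R^-1) hq h => r hr h; exists N1 => N /h {}h t /h {}h; lra.
exists k; split=> [e /Fk[N1 h]|t].
  exists N1 => N /h {}h t; rewrite in_itv/= => /h.
  by rewrite normc_cabs ltcR.
rewrite in_itv/= => t01.
have : 0 < p.+1%:R^-1 :> R by rewrite invr_gt0.
move: (p.+1%:R^-1) hf => e hf e0; have [N1 h] := Fk _ e0.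
rewrite normc_cabs ltcR; apply: le_lt_trans (cabs_distD (F (maxn N0 N1) t) _ _) _.
have := h _ (leq_maxr N0 N1) _ t01; have := hf _ (leq_maxl N0 N1) _ t01.
by rewrite (cabs_distC (k t)); lra.
Qed.

(** An enumeration of the rationals of [0,1]. Capping at 1 makes every pair admissible, so countable
    intersections run over all pairs. *)
Definition grid (km : nat * nat) : R := Num.min 1 (km.1%:R / km.2.+1%:R).

Lemma grid01 km : 0 <= grid km <= 1.
Proof. by rewrite /grid le_min ler01 divr_ge0//= ge_min lexx. Qed.

Lemma grid_approx (t : R) m : 0 <= t <= 1 ->
  exists2 k, (k <= m.+1)%N & `|t - k%:R / m.+1%:R| <= m.+1%:R^-1.
Proof.
move=> /andP[t0 t1]; exists (Num.truncn (t * m.+1%:R)).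
  rewrite -(ler_nat R); apply: le_trans (_ : t * m.+1%:R <= _).
    by rewrite truncn_le mulr_ge0.
  by rewrite ler_piMl.
have h1 : (Num.truncn (t * m.+1%:R))%:R <= t * m.+1%:R by rewrite truncn_le mulr_ge0.
have h2 := truncnS_gt (t * m.+1%:R).
have m0 : 0 < m.+1%:R :> R by [].
rewrite ger0_norm; last by rewrite subr_ge0 ler_pdivrMr.
rewrite lerBlDl -[X in _ <= _ + X]mul1r -mulrDl ler_pdivlMr// natr1 ltW//.
Qed.

Lemma grid_dense u (c : R) : c01 u -> (forall km, u (grid km) <= c) ->
  forall t, 0 <= t <= 1 -> u t <= c.
Proof.
move=> /within01P cu h t t01; apply/ler_addgt0Pr => e e0.
have [r r0 hr] := cu _ t01 _ e0.
have [m hm] := inv_succ_lt r0.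
have [k km hk] := grid_approx m t01.
have E : grid (k, m) = k%:R / m.+1%:R.
  by apply/min_idPr; rewrite /= ler_pdivrMr// mul1r ler_nat.
have := hr _ (grid01 (k, m)); rewrite E => /(_ (le_lt_trans hk hm)) h1.
have := h (k, m); rewrite E => h2.
by have := ler_norm (u t - u (k%:R / m.+1%:R)); lra.
Qed.

End uniform_limits.

Section partial_sums.
Context (R : realType).
Local Notation c01 u := ({within `[0%R, 1%R], continuous (u : R -> R)}).

Definition sin_basis (n : nat) (t : R) : R := sinn n t / (2 * pi * n%:R).
Definition cos_basis (n : nat) (t : R) : R := (1 - cosn n t) / (2 * pi * n%:R).

(** Frequencies k and -k share one basis function up to the sign [sg], which is 1 for the real part
    and -1 for the imaginary part; the tail estimate is proved once for both. *)
Definition pair_sum (b : nat -> R -> R) (sg : R) (x : int -> R) (m n : nat) (t : R) : R :=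
  \sum_(m <= k < n) b k t * (x (Posz k) + sg * x (- Posz k)).

Definition reK (N : nat) (x : int -> R) (t : R) : R :=
  t * x 0 + pair_sum sin_basis 1 x 1 N.+1 t.
Definition imK (N : nat) (x : int -> R) (t : R) : R :=
  pair_sum cos_basis (-1) x 1 N.+1 t.

Lemma K_term_complex (w c s x : R) : w != 0 ->
  ((c +i* s) - 1) / (w%:C * 'i) * x%:C = (s / w * x) +i* ((1 - c) / w * x).
Proof.
move=> w0.
have i0 : w%:C * 'i%C != 0 :> R[i].
  by rewrite eq_complex /= !mulr0 !mulr1 addr0 subrr eqxx.
have -> : ((c +i* s) - 1) / (w%:C * 'i) = (s / w) +i* ((1 - c) / w) :> R[i].
  apply: (canLR (mulfK i0)); apply/eqP; rewrite eq_complex /=.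
  by apply/andP; split; apply/eqP; field.
by apply/eqP; rewrite eq_complex /=; apply/andP; split; apply/eqP; ring.
Qed.

Lemma K_partialE (T : Type) (ST : int -> T -> R) N w t :
  K_partial ST N w t = (reK N (ST^~ w) t) +i* (imK N (ST^~ w) t).
Proof.
rewrite /K_partial /reK /imK; elim: N => [|N IH].
  by rewrite /pair_sum !big_geq// !addr0.
rewrite /pair_sum !(@big_nat_recr _ _ _ N.+1)//= addrA IH.
have w0 : 2 * pi * N.+1%:R != 0 :> R by rewrite gt_eqF ?freq_gt0.
have wN : 2 * pi * (- Posz N.+1)%:~R = - (2 * pi * N.+1%:R) :> R.
  by rewrite mulrNz mulrN.
have w0' : - (2 * pi * N.+1%:R) != 0 :> R by rewrite oppr_eq0.
rewrite /ee wN !K_term_complex//.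
have -> : 2 * pi * ((- Posz N.+1)%:~R * t) = - (2 * pi * (N.+1%:R * t)) :> R.
  by rewrite mulrNz; ring.
rewrite cosN sinN /sin_basis /cos_basis /sinn /cosn /phase /pair_sum.
move: (2 * pi * N.+1%:R) w0 {wN w0'} => a a0.
by apply/eqP; rewrite eq_complex /=; apply/andP; split; apply/eqP; field.
Qed.

Lemma within01_sin_basis n : c01 (sin_basis n).
Proof. by apply: within01M; [exact: within01_sinn|exact: within01_const]. Qed.

Lemma within01_cos_basis n : c01 (cos_basis n).
Proof.
apply: within01M; last exact: within01_const.
by apply: within01B; [exact: within01_const|exact: within01_cosn].
Qed.

Lemma within01_id : c01 (fun t => t).
Proof. by apply: continuous_subspaceT => x; exact: cvg_id. Qed.

Lemma within01_pair_sum b sg x m n : (forall k, c01 (b k)) -> c01 (pair_sum b sg x m n).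
Proof.
move=> cb; apply: within01_sum => k.
by apply: within01M => //; exact: within01_const.
Qed.

Lemma within01_reK N x : c01 (reK N x).
Proof.
apply: within01D; last exact/within01_pair_sum/within01_sin_basis.
by apply: within01M; [exact: within01_id|exact: within01_const].
Qed.

Lemma within01_imK N x : c01 (imK N x).
Proof. exact/within01_pair_sum/within01_cos_basis. Qed.

Context d (T : measurableType d) (ST : int -> T -> R).
Hypothesis mST : forall h, measurable_fun setT (ST h).

Lemma measurable_pair_sum b sg m n t :
  measurable_fun setT (fun w => pair_sum b sg (ST^~ w) m n t).
Proof.
apply: measurable_sum => k; apply: measurable_funM; first exact: measurable_cst.
apply: measurable_funD; first exact: mST.
by apply: measurable_funM; [exact: measurable_cst|exact: mST].
Qed.

Lemma measurable_reK N t : measurable_fun setT (fun w => reK N (ST^~ w) t).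
Proof.
apply: measurable_funD; last exact: measurable_pair_sum.
by apply: measurable_funM; [exact: measurable_cst|exact: mST].
Qed.

Lemma measurable_imK N t : measurable_fun setT (fun w => imK N (ST^~ w) t).
Proof. exact: measurable_pair_sum. Qed.

Lemma measurable_cabs_le (G : T -> R[i]) (c : R) :
  measurable_fun setT (fun w => complex.Re (G w)) ->
  measurable_fun setT (fun w => complex.Im (G w)) ->
  measurable [set w | cabs (G w) <= c].
Proof.
move=> mR mI.
have m : measurable_fun setT (fun w => cabs (G w)).
  apply: (measurableT_comp (continuous_measurable_fun (@sqrt_continuous R))).
  by apply: measurable_funD; exact: measurable_funX.
rewrite -[X in measurable X]setTI.
rewrite (_ : [set w | _] = (fun w => cabs (G w)) @^-1` `]-oo, c]); first exact: m.
by apply/seteqP; split => w /=; rewrite in_itv.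
Qed.

Lemma within01_ReK_partial N w : c01 (fun t => complex.Re (K_partial ST N w t)).
Proof.
rewrite (_ : (fun t => _) = reK N (ST^~ w)); first exact: within01_reK.
by apply/funext => t; rewrite K_partialE.
Qed.

Lemma within01_ImK_partial N w : c01 (fun t => complex.Im (K_partial ST N w t)).
Proof.
rewrite (_ : (fun t => _) = imK N (ST^~ w)); first exact: within01_imK.
by apply/funext => t; rewrite K_partialE.
Qed.

Lemma support_eventE (f : R -> R[i]) (eps : R) w :
  c01 (fun t => complex.Re (f t)) -> c01 (fun t => complex.Im (f t)) ->
  (exists k : R -> R[i], K_unif_limit ST w k /\ sup_ball f eps k) <->
  (forall p : nat, exists N0, forall N M, (N0 <= N)%N -> (N0 <= M)%N ->
      forall t, 0 <= t <= 1 ->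
      cabs (K_partial ST N w t - K_partial ST M w t) <= p.+1%:R^-1) /\
  (exists p N0 : nat, forall N, (N0 <= N)%N -> forall t, 0 <= t <= 1 ->
      cabs (K_partial ST N w t - f t) <= eps - p.+1%:R^-1).
Proof.
move=> f1 f2; apply: uniform_limit_sup_ballP => // N.
  exact: within01_ReK_partial.
exact: within01_ImK_partial.
Qed.

(** By [support_eventE] and continuity in [t], the event is a countable combination of closed
    conditions at grid points. Indices [N0 + N] encode the constraint of being at least [N0]. *)
Lemma support_event_measurable (f : R -> R[i]) (eps : R) :
  c01 (fun t => complex.Re (f t)) -> c01 (fun t => complex.Im (f t)) ->
  measurable [set w | exists k : R -> R[i], K_unif_limit ST w k /\ sup_ball f eps k].
Proof.
move=> f1 f2.
pose K N w t := K_partial ST N w t.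
rewrite (_ : [set w | _] =
  (\bigcap_p \bigcup_N0 \bigcap_N \bigcap_M \bigcap_i \bigcap_j
     [set w | cabs (K (N0 + N)%N w (grid R (i, j)) - K (N0 + M)%N w (grid R (i, j)))
              <= p.+1%:R^-1]) `&`
  (\bigcup_p \bigcup_N0 \bigcap_N \bigcap_i \bigcap_j
     [set w | cabs (K (N0 + N)%N w (grid R (i, j)) - f (grid R (i, j)))
              <= eps - p.+1%:R^-1])).
  apply: measurableI.
    apply: bigcapT_measurable => p; apply: bigcupT_measurable => N0.
    do 4!apply: bigcapT_measurable => ?; apply: measurable_cabs_le.
      under eq_fun do rewrite Re_sub /K !K_partialE.
      by apply: measurable_funB; exact: measurable_reK.
    under eq_fun do rewrite Im_sub /K !K_partialE.
    by apply: measurable_funB; exact: measurable_imK.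
  do 2!apply: bigcupT_measurable => ?.
  do 3!apply: bigcapT_measurable => ?; apply: measurable_cabs_le.
    under eq_fun do rewrite Re_sub /K !K_partialE.
    by apply: measurable_funB; [exact: measurable_reK|exact: measurable_cst].
  under eq_fun do rewrite Im_sub /K !K_partialE.
  by apply: measurable_funB; [exact: measurable_imK|exact: measurable_cst].
apply/seteqP; split=> w /=.
  move=> /(support_eventE _ _ f1 f2)[h1 [p [N0 h2]]]; split.
    move=> q _; have [N1 h] := h1 q; exists N1 => // N _ M _ i _ j _ /=.
    by apply: h; rewrite ?leq_addr// grid01.
  exists p => //; exists N0 => // N _ i _ j _ /=.
  by apply: h2; rewrite ?leq_addr// grid01.
move=> [h1 [p _ [N0 _ h2]]]; apply/(support_eventE _ _ f1 f2); split.
  move=> q; have [N1 _ h] := h1 q I; exists N1 => N M hN hM.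
  apply: grid_dense.
    by apply: within01_cabs; [exact: within01_ReK_partial|exact: within01_ImK_partial
      |exact: within01_ReK_partial|exact: within01_ImK_partial].
  move=> [i j]; have := h (N - N1)%N I (M - N1)%N I i I j I.
  by rewrite /= /K !subnKC.
exists p, N0 => N hN; apply: grid_dense.
  by apply: within01_cabs => //; [exact: within01_ReK_partial|exact: within01_ImK_partial].
move=> [i j]; have := h2 (N - N0)%N I i I j I.
by rewrite /= /K !subnKC.
Qed.

End partial_sums.

(** * Fourier coefficients *)

Section fourier.
Context (R : realType).
Local Notation c01 u := ({within `[0%R, 1%R], continuous (u : R -> R)}).
Local Notation I01 u := (\int[lebesgue_measure]_(t in `[0%R, 1%R]) u t).
Implicit Types (u v : R -> R) (t : R) (n k N : nat).

Lemma phaseD n k t : phase (n + k) t = phase n t + phase k t.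
Proof. by rewrite /phase natrD; ring. Qed.

Lemma phaseB n k t : (k <= n)%N -> phase (n - k) t = phase n t - phase k t.
Proof. by move=> kn; rewrite /phase natrB//; ring. Qed.

Lemma cosn_cosn n k t : (k <= n)%N ->
  cosn k t * cosn n t = 2^-1 * cosn (n - k) t + 2^-1 * cosn (n + k) t.
Proof. by move=> kn; rewrite /cosn phaseB// phaseD cosB cosD; lra. Qed.

Lemma sinn_sinn n k t : (k <= n)%N ->
  sinn k t * sinn n t = 2^-1 * cosn (n - k) t - 2^-1 * cosn (n + k) t.
Proof. by move=> kn; rewrite /cosn /sinn phaseB// phaseD cosB cosD; lra. Qed.

Lemma sinn_cosn n k t : sinn k t * cosn n t = 2^-1 * sinn (n + k) t -
   (if (k <= n)%N then 2^-1 * sinn (n - k) t else - 2^-1 * sinn (k - n) t).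
Proof.
rewrite /cosn /sinn phaseD sinD; case: leqP => kn.
  by rewrite phaseB// sinB; lra.
by rewrite phaseB ?(ltnW kn)// sinB; lra.
Qed.

Lemma Rintegral01_sinn_all n : I01 (@sinn R n) = 0.
Proof.
case: n => [|n]; last exact: Rintegral01_sinn.
rewrite (_ : @sinn R 0 = fun=> 0) ?Rintegral01_const//.
by apply/funext => t; rewrite /sinn /phase mul0r mulr0 sin0.
Qed.

Let within01_cosnZ (c : R) n : c01 (fun t => c * cosn n t).
Proof. by apply: within01M; [exact: within01_const|exact: within01_cosn]. Qed.

Let within01_sinnZ (c : R) n : c01 (fun t => c * sinn n t).
Proof. by apply: within01M; [exact: within01_const|exact: within01_sinn]. Qed.

Lemma orthogonal_sin_cos n k : I01 (fun t => sinn k t * cosn n t) = 0.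
Proof.
under eq_Rintegral do rewrite sinn_cosn.
case: leqP => kn; rewrite Rintegral01B ?Rintegral01Z; try exact: within01_sinnZ;
  try exact: within01_sinn; by rewrite !Rintegral01_sinn_all !mulr0 subr0.
Qed.

Lemma orthogonal_cos_cos n k : (0 < n)%N -> (0 < k)%N ->
  I01 (fun t => cosn k t * cosn n t) = (k == n)%:R / 2.
Proof.
wlog kn : k n / (k <= n)%N => [hw n0 k0|n0 k0].
  have [|/ltnW] := leqP k n; first by move=> /hw; exact.
  move=> /hw/(_ k0 n0); rewrite eq_sym => <-.
  by apply: eq_Rintegral => t _; rewrite mulrC.
under eq_Rintegral do rewrite cosn_cosn//.
rewrite Rintegral01D ?Rintegral01Z; try exact: within01_cosnZ; try exact: within01_cosn.
rewrite (@Rintegral01_cosn _ (n + k)) ?addn_gt0 ?n0// mulr0 addr0.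
have [->|nk] := eqVneq k n.
  rewrite subnn (_ : @cosn R 0 = fun=> 1) ?Rintegral01_const ?mul1r ?mulr1//.
  by apply/funext => t; rewrite cosn0E.
by rewrite Rintegral01_cosn ?mulr0 ?mul0r// subn_gt0 ltn_neqAle nk.
Qed.

Lemma orthogonal_sin_sin n k : (0 < n)%N -> (0 < k)%N ->
  I01 (fun t => sinn k t * sinn n t) = (k == n)%:R / 2.
Proof.
wlog kn : k n / (k <= n)%N => [hw n0 k0|n0 k0].
  have [|/ltnW] := leqP k n; first by move=> /hw; exact.
  move=> /hw/(_ k0 n0); rewrite eq_sym => <-.
  by apply: eq_Rintegral => t _; rewrite mulrC.
under eq_Rintegral do rewrite sinn_sinn//.
rewrite Rintegral01B ?Rintegral01Z; try exact: within01_cosnZ; try exact: within01_cosn.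
rewrite (@Rintegral01_cosn _ (n + k)) ?addn_gt0 ?n0// mulr0 subr0.
have [->|nk] := eqVneq k n.
  rewrite subnn (_ : @cosn R 0 = fun=> 1) ?Rintegral01_const ?mul1r ?mulr1//.
  by apply/funext => t; rewrite cosn0E.
by rewrite Rintegral01_cosn ?mulr0 ?mul0r// subn_gt0 ltn_neqAle nk.
Qed.

Lemma cos_coef_dist u v n (e : R) : c01 u -> c01 v ->
  (forall t, 0 <= t <= 1 -> `|u t - v t| <= e) -> `|cos_coef u n - cos_coef v n| <= e.
Proof.
move=> cu cv h; have cc := @within01_cosn R n.
rewrite /cos_coef -Rintegral01B; try exact: within01M.
rewrite -[X in _ <= X]Rintegral01_const; apply: Rintegral01_norm_le.
- by apply: within01B; exact: within01M.
- exact: within01_const.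
move=> t t01; rewrite -mulrBl normrM -[X in _ <= X]mulr1 ler_pM//; first exact: h.
exact: cos_max.
Qed.

Lemma sin_coef_dist u v n (e : R) : c01 u -> c01 v ->
  (forall t, 0 <= t <= 1 -> `|u t - v t| <= e) -> `|sin_coef u n - sin_coef v n| <= e.
Proof.
move=> cu cv h; have cc := @within01_sinn R n.
rewrite /sin_coef -Rintegral01B; try exact: within01M.
rewrite -[X in _ <= X]Rintegral01_const; apply: Rintegral01_norm_le.
- by apply: within01B; exact: within01M.
- exact: within01_const.
move=> t t01; rewrite -mulrBl normrM -[X in _ <= X]mulr1 ler_pM//; first exact: h.
exact: sin_max.
Qed.

Lemma sum_pick (F : nat -> R) n N : (0 < n <= N)%N ->
  \sum_(1 <= k < N.+1) F k * ((k == n)%:R / 2) = F n / 2.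
Proof.
move=> /andP[n0 nN]; rewrite (bigD1_seq n)/= ?iota_uniq//; last first.
  by rewrite mem_index_iota n0.
by rewrite eqxx mul1r big1 ?addr0// => k /negbTE ->; rewrite mul0r mulr0.
Qed.

Lemma pair_sum_coef b sg x N n (W : nat -> R -> R) (F : nat -> R) :
  (forall k, c01 (b k)) -> c01 (W n) ->
  (forall k, (0 < k)%N -> I01 (fun t => b k t * W n t) = F k) ->
  I01 (fun t => pair_sum b sg x 1 N.+1 t * W n t) =
  \sum_(1 <= k < N.+1) (x (Posz k) + sg * x (- Posz k)) * F k.
Proof.
move=> cb cW h.
have E t : pair_sum b sg x 1 N.+1 t * W n t =
    \sum_(1 <= k < N.+1) (x (Posz k) + sg * x (- Posz k)) * (b k t * W n t).
  by rewrite /pair_sum mulr_suml; apply: eq_bigr => k _; ring.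
under eq_Rintegral do rewrite E.
rewrite Rintegral01_sum; last first.
  by move=> k; apply: within01M; [exact: within01_const|exact: within01M].
rewrite big_nat [in RHS]big_nat; apply: eq_bigr => k /andP[k0 _].
by rewrite Rintegral01Z ?h//; exact: within01M.
Qed.

Lemma pair_sum_sin_cos_coef x N n : cos_coef (pair_sum (@sin_basis R) 1 x 1 N.+1) n = 0.
Proof.
rewrite /cos_coef (@pair_sum_coef _ _ _ _ n (@cosn R) (fun=> 0)).
- by rewrite big1// => k _; rewrite mulr0.
- exact: within01_sin_basis.
- exact: within01_cosn.
move=> k k0; rewrite (_ : (fun t => _) = (fun t => (2 * pi * k%:R)^-1 * (sinn k t * cosn n t))).
  rewrite Rintegral01Z ?orthogonal_sin_cos ?mulr0//.
  by apply: within01M; [exact: within01_sinn|exact: within01_cosn].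
by apply/funext => t; rewrite /sin_basis; ring.
Qed.

Lemma pair_sum_sin_sin_coef x N n : (0 < n <= N)%N ->
  sin_coef (pair_sum (@sin_basis R) 1 x 1 N.+1) n =
  (x (Posz n) + x (- Posz n)) / (2 * pi * n%:R) / 2.
Proof.
move=> nN; rewrite /sin_coef (@pair_sum_coef _ _ _ _ n (@sinn R)
  (fun k => (2 * pi * k%:R)^-1 * ((k == n)%:R / 2))).
- rewrite (eq_bigr (fun k => (x (Posz k) + x (- Posz k)) / (2 * pi * k%:R) *
    ((k == n)%:R / 2))) ?sum_pick// => k _.
  by ring.
- exact: within01_sin_basis.
- exact: within01_sinn.
move=> k k0; rewrite -orthogonal_sin_sin//; last by case/andP: nN.
rewrite -Rintegral01Z; last by apply: within01M; exact: within01_sinn.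
by apply: eq_Rintegral => t _; rewrite /sin_basis; ring.
Qed.

(** The constant 1 in 1 - cos is orthogonal to [W n]. *)
Lemma cos_basis_coef k n (W : nat -> R -> R) : c01 (W n) -> I01 (W n) = 0 ->
  I01 (fun t => cos_basis k t * W n t) =
  - (2 * pi * k%:R)^-1 * I01 (fun t => cosn k t * W n t).
Proof.
move=> cW W0; have cc : c01 (fun t => cosn k t * W n t).
  by apply: within01M => //; exact: within01_cosn.
rewrite (_ : (fun t => _) = (fun t => (2 * pi * k%:R)^-1 * W n t -
  (2 * pi * k%:R)^-1 * (cosn k t * W n t))); last first.
  by apply/funext => t; rewrite /cos_basis; ring.
rewrite Rintegral01B; last 2 first.
  by apply: within01M => //; exact: within01_const.
  by apply: within01M => //; exact: within01_const.
by rewrite !Rintegral01Z// W0 mulr0 sub0r mulNr.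
Qed.

Lemma pair_sum_cos_sin_coef x N n : sin_coef (pair_sum (@cos_basis R) (-1) x 1 N.+1) n = 0.
Proof.
rewrite /sin_coef (@pair_sum_coef _ _ _ _ n (@sinn R) (fun=> 0)).
- by rewrite big1// => k _; rewrite mulr0.
- exact: within01_cos_basis.
- exact: within01_sinn.
move=> k k0; rewrite (@cos_basis_coef k n (@sinn R)) ?Rintegral01_sinn_all//.
  under eq_Rintegral do rewrite mulrC.
  by rewrite orthogonal_sin_cos mulr0.
exact: within01_sinn.
Qed.

Lemma pair_sum_cos_cos_coef x N n : (0 < n <= N)%N ->
  cos_coef (pair_sum (@cos_basis R) (-1) x 1 N.+1) n =
  - (x (Posz n) - x (- Posz n)) / (2 * pi * n%:R) / 2.
Proof.
move=> nN; have n0 : (0 < n)%N by case/andP: nN.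
rewrite /cos_coef (@pair_sum_coef _ _ _ _ n (@cosn R)
  (fun k => - (2 * pi * k%:R)^-1 * ((k == n)%:R / 2))).
- under eq_bigr do rewrite mulrA.
  by rewrite sum_pick// mulN1r; ring.
- exact: within01_cos_basis.
- exact: within01_cosn.
move=> k k0; rewrite (@cos_basis_coef k n (@cosn R)) ?Rintegral01_cosn//.
  by rewrite orthogonal_cos_cos.
exact: within01_cosn.
Qed.

Lemma fourier_coef_pos (g : R -> R[i]) n :
  c01 (fun t => complex.Re (g t)) -> c01 (fun t => complex.Im (g t)) ->
  fourier_coef g (Posz n) =
  (cos_coef (fun t => complex.Re (g t)) n + sin_coef (fun t => complex.Im (g t)) n) +i*
  (cos_coef (fun t => complex.Im (g t)) n - sin_coef (fun t => complex.Re (g t)) n).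
Proof.
move=> c1 c2; have cc := @within01_cosn R n; have cs := @within01_sinn R n.
rewrite /fourier_coef; congr (_ +i* _).
  rewrite /cos_coef /sin_coef -Rintegral01D; try exact: within01M.
  apply: eq_Rintegral => t _; rewrite /ee mulrN cosN sinN /cosn /sinn /phase.
  by case: (g t) => a b /=; ring.
rewrite /cos_coef /sin_coef -Rintegral01B; try exact: within01M.
apply: eq_Rintegral => t _; rewrite /ee mulrN cosN sinN /cosn /sinn /phase.
by case: (g t) => a b /=; ring.
Qed.

Lemma fourier_coef_neg (g : R -> R[i]) n :
  c01 (fun t => complex.Re (g t)) -> c01 (fun t => complex.Im (g t)) ->
  fourier_coef g (- Posz n) =
  (cos_coef (fun t => complex.Re (g t)) n - sin_coef (fun t => complex.Im (g t)) n) +i*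
  (cos_coef (fun t => complex.Im (g t)) n + sin_coef (fun t => complex.Re (g t)) n).
Proof.
move=> c1 c2; have cc := @within01_cosn R n; have cs := @within01_sinn R n.
rewrite /fourier_coef; congr (_ +i* _).
  rewrite /cos_coef /sin_coef -Rintegral01B; try exact: within01M.
  apply: eq_Rintegral => t _; rewrite /ee mulrNz mulNr opprK /cosn /sinn /phase.
  by case: (g t) => a b /=; ring.
rewrite /cos_coef /sin_coef -Rintegral01D; try exact: within01M.
apply: eq_Rintegral => t _; rewrite /ee mulrNz mulNr opprK /cosn /sinn /phase.
by case: (g t) => a b /=; ring.
Qed.

(** The real parts at n and -n are the sum and the difference of two real coefficients, so both
    vanish exactly when each coefficient does; the moduli are then those of the imaginary parts. *)
Lemma fourier_conditionP (g : R -> R[i]) :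
  c01 (fun t => complex.Re (g t)) -> c01 (fun t => complex.Im (g t)) ->
  (forall h : int, h != 0 -> complex.Re (fourier_coef g h) = 0 /\
        `|fourier_coef g h| <= ((pi * `|h|%:~R)^-1)%:C) <->
  (forall n, (0 < n)%N ->
     [/\ cos_coef (fun t => complex.Re (g t)) n = 0,
         sin_coef (fun t => complex.Im (g t)) n = 0,
         `|cos_coef (fun t => complex.Im (g t)) n - sin_coef (fun t => complex.Re (g t)) n|
            <= (pi * n%:R)^-1
       & `|cos_coef (fun t => complex.Im (g t)) n + sin_coef (fun t => complex.Re (g t)) n|
            <= (pi * n%:R)^-1]).
Proof.
move=> c1 c2; have P n := fourier_coef_pos n c1 c2; have M n := fourier_coef_neg n c1 c2.
have cabs0 (y : R) : cabs (0 +i* y) = `|y| by rewrite /cabs/= expr0n add0r sqrtr_sqr.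
split=> [h n n0|h].
  have [] := h (Posz n); first by rewrite -lt0n.
  have [] := h (- Posz n); first by rewrite oppr_eq0 -lt0n.
  rewrite P M /= => h1 + h2.
  have a0 : cos_coef (fun t => complex.Re (g t)) n = 0 by lra.
  have b0 : sin_coef (fun t => complex.Im (g t)) n = 0 by lra.
  by rewrite h1 h2 !normc_cabs !lecR !cabs0 normrN.
suff H n : (0 < n)%N -> (complex.Re (fourier_coef g (Posz n)) = 0 /\
    `|fourier_coef g (Posz n)| <= ((pi * n%:R)^-1)%:C) /\
   (complex.Re (fourier_coef g (- Posz n)) = 0 /\
    `|fourier_coef g (- Posz n)| <= ((pi * n%:R)^-1)%:C).
  case=> [n|n] n0; first by have [] := H n; rewrite // lt0n.
  by rewrite NegzE normrN; have [] := H n.+1.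
move=> /h[a0 b0 h1 h2]; rewrite P M /= a0 b0 addr0 subr0.
by rewrite !normc_cabs !lecR !cabs0.
Qed.

Lemma reK0 N x : reK N x 0 = 0 :> R.
Proof.
rewrite /reK mul0r add0r /pair_sum big1// => k _.
by rewrite /sin_basis sinn0 mul0r mul0r.
Qed.

Lemma imK0 N x : imK N x 0 = 0 :> R.
Proof.
rewrite /imK /pair_sum big1// => k _.
by rewrite /cos_basis cosn0 subrr mul0r mul0r.
Qed.

Lemma reK1 N x : reK N x 1 = x 0 :> R.
Proof.
rewrite /reK mul1r /pair_sum big1 ?addr0// => k _.
by rewrite /sin_basis sinn1 mul0r mul0r.
Qed.

Lemma imK1 N x : imK N x 1 = 0 :> R.
Proof.
rewrite /imK /pair_sum big1// => k _.
by rewrite /cos_basis cosn1 subrr mul0r mul0r.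
Qed.

Lemma le0_small (a : R) : (forall e : R, 0 < e -> a <= e) -> a <= 0.
Proof. by move=> h; apply/ler_addgt0Pr => e /h; rewrite add0r. Qed.

Lemma norm_small (a : R) : (forall e : R, 0 < e -> `|a| <= e) -> a = 0.
Proof. by move=> /le0_small; rewrite normr_le0 => /eqP. Qed.

(* The Fourier conditions hold for partial sums with coefficients in [-2, 2],
   and they are preserved under uniform limits. *)
Lemma support_necessary (f : R -> R[i]) :
  c01 (fun t => complex.Re (f t)) -> c01 (fun t => complex.Im (f t)) ->
  (forall e : R, 0 < e -> forall N0, exists N (x : int -> R),
   [/\ (N0 <= N)%N, forall h : int, `|x h| <= 2,
     forall t, 0 <= t <= 1 -> `|complex.Re (f t) - reK N x t| <= e
   & forall t, 0 <= t <= 1 -> `|complex.Im (f t) - imK N x t| <= e]) ->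
  [/\ f 0 = 0,
      exists x : R, -2 <= x <= 2 /\ f 1 = x%:C
    & forall h : int, h != 0 ->
        let g := fun t : R => f t - t%:C * f 1 in
        complex.Re (fourier_coef g h) = 0 /\
        `|fourier_coef g h| <= ((pi * `|h|%:~R)^-1)%:C].
Proof.
move=> c1 c2 H.
have i0 : 0 <= (0 : R) <= 1 by rewrite lexx ler01.
have i1 : 0 <= (1 : R) <= 1 by rewrite lexx ler01.
have r0 : complex.Re (f 0) = 0.
  apply: norm_small => e /H /(_ 0%N)[N [x [_ _ /(_ _ i0) + _]]].
  by rewrite reK0 subr0.
have s0 : complex.Im (f 0) = 0.
  apply: norm_small => e /H /(_ 0%N)[N [x [_ _ _ /(_ _ i0)]]].
  by rewrite imK0 subr0.
have s1 : complex.Im (f 1) = 0.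
  apply: norm_small => e /H /(_ 0%N)[N [x [_ _ _ /(_ _ i1)]]].
  by rewrite imK1 subr0.
have r1 : `|complex.Re (f 1)| <= 2.
  apply/ler_addgt0Pr => e /H /(_ 0%N)[N [x [_ /(_ 0) x2 /(_ _ i1) + _]]].
  rewrite reK1 => h.
  by have := ler_distD (x 0) (complex.Re (f 1)) 0; rewrite !subr0; lra.
have f1E : f 1 = (complex.Re (f 1))%:C by rewrite [LHS](complexE (f 1)) s1 mulr0 addr0.
split.
- by rewrite (complexE (f 0)) r0 s0 mulr0 addr0.
- by exists (complex.Re (f 1)); split; [rewrite -ler_norml|].
pose g := fun t : R => f t - t%:C * f 1.
have g1E t : complex.Re (g t) = complex.Re (f t) - t * complex.Re (f 1).
  by rewrite /g Re_sub f1E /= mul0r subr0.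
have g2E t : complex.Im (g t) = complex.Im (f t).
  by rewrite /g Im_sub f1E /= mulr0 mul0r addr0 subr0.
have g1F : (fun t => complex.Re (g t)) = (fun t => complex.Re (f t) - t * complex.Re (f 1)).
  by apply/funext => t.
have g2F : (fun t => complex.Im (g t)) = (fun t => complex.Im (f t)) by apply/funext => t.
have cg1 : c01 (fun t => complex.Re (g t)).
  rewrite g1F; apply: within01B => //.
  by apply: within01M; [exact: within01_id|exact: within01_const].
have cg2 : c01 (fun t => complex.Im (g t)) by rewrite g2F.
apply/(fourier_conditionP cg1 cg2) => n n0.
have H' (e : R) : 0 < e -> exists x : int -> R, [/\ forall h : int, `|x h| <= 2,
    `|cos_coef (fun t => complex.Re (g t)) n| <= e,
    `|sin_coef (fun t => complex.Re (g t)) n -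
      (x (Posz n) + x (- Posz n)) / (2 * pi * n%:R) / 2| <= e,
    `|sin_coef (fun t => complex.Im (g t)) n| <= e
  & `|cos_coef (fun t => complex.Im (g t)) n +
      (x (Posz n) - x (- Posz n)) / (2 * pi * n%:R) / 2| <= e].
  move=> e0; have e20 : 0 < e / 2 by rewrite divr_gt0.
  (* Taking [N] at least [n] makes the partial sum contain the frequency n. The error e/2 is paid
     twice, at [t] and at 1, since [g] subtracts t f(1). *)
  have [N [x [nN x2 h1 h2]]] := H _ e20 n; exists x.
  have d1 t : 0 <= t <= 1 ->
      `|complex.Re (g t) - pair_sum (@sin_basis R) 1 x 1 N.+1 t| <= e.
    move=> t01; rewrite g1E; have := h1 _ t01; have := h1 _ i1; rewrite reK1 /reK.
    move: t01 => /andP[t0 t1].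
    set a := complex.Re (f t); set b := complex.Re (f 1); set p := pair_sum _ _ _ _ _ _.
    rewrite !ler_norml => /andP[k1 k2] /andP[k3 k4].
    by apply/andP; split; nra.
  have d2 t : 0 <= t <= 1 ->
      `|complex.Im (g t) - pair_sum (@cos_basis R) (-1) x 1 N.+1 t| <= e.
    by move=> /h2 h; rewrite g2E; apply: le_trans h _; lra.
  have cp := @within01_pair_sum R _ 1 x 1%N N.+1 (@within01_sin_basis R).
  have cq := @within01_pair_sum R _ (-1) x 1%N N.+1 (@within01_cos_basis R).
  have nN' : (0 < n <= N)%N by rewrite n0.
  split => //.
  - by have := cos_coef_dist n cg1 cp d1; rewrite pair_sum_sin_cos_coef subr0.
  - by have := sin_coef_dist n cg1 cp d1; rewrite pair_sum_sin_sin_coef.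
  - by have := sin_coef_dist n cg2 cq d2; rewrite pair_sum_cos_sin_coef subr0.
  - by have := cos_coef_dist n cg2 cq d2; rewrite pair_sum_cos_cos_coef// !mulNr opprK.
have w0 := freq_gt0 R n0.
have pE : (pi * n%:R)^-1 = 2 / (2 * pi * n%:R) :> R.
  by rewrite -(mulrA 2) [in RHS]invfM mulrA divff ?mul1r.
have bound (y : R) : `|y| <= 2 -> `|y / (2 * pi * n%:R)| <= (pi * n%:R)^-1.
  move=> y2; rewrite pE normrM [X in _ * X]gtr0_norm ?invr_gt0//.
  by rewrite ler_pM2r ?invr_gt0.
split.
- by apply: norm_small => e /H'[x []].
- by apply: norm_small => e /H'[x []].
(* In the difference of the two coefficients x_{-n} cancels and -x_n / (2 pi n) remains; in the sum,
   treated next, x_{-n} / (2 pi n) remains. *)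
- apply/ler_addgt0Pr => e e0; have e20 : 0 < e / 2 by rewrite divr_gt0.
  have [x [x2 _ h1 _ h2]] := H' _ e20.
  have := bound _ (x2 (Posz n)); move: h1 h2.
  rewrite !ler_norml => /andP[k1 k2] /andP[k3 k4] /andP[k5 k6].
  by apply/andP; split; lra.
- apply/ler_addgt0Pr => e e0; have e20 : 0 < e / 2 by rewrite divr_gt0.
  have [x [x2 _ h1 _ h2]] := H' _ e20.
  have := bound _ (x2 (- Posz n)); move: h1 h2.
  rewrite !ler_norml => /andP[k1 k2] /andP[k3 k4] /andP[k5 k6].
  by apply/andP; split; lra.
Qed.

Lemma pair_sum_truncate (b : nat -> R -> R) sg x L N t :
  (forall n, (L <= n)%N -> x (Posz n) = 0 /\ x (- Posz n) = 0) ->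
  (0 < L)%N -> (L <= N)%N -> pair_sum b sg x 1 N t = pair_sum b sg x 1 L t.
Proof.
move=> x0 L0 LN; rewrite /pair_sum (@big_cat_nat _ _ _ L)//=.
rewrite [X in _ + X]big_nat [X in _ + X]big1 ?addr0// => n /andP[/x0[-> ->] _].
by rewrite mulr0 addr0 mulr0.
Qed.

(* The Fejer means of [f t - t f(1)] are partial sums [K_N] with coefficients
   [y h = (1 - |h| / N) x h], where [x h = 2 i pi h g^(h)]. *)
Lemma support_approx (f : R -> R[i]) :
  c01 (fun t => complex.Re (f t)) -> c01 (fun t => complex.Im (f t)) ->
  f 0 = 0 -> (exists x : R, -2 <= x <= 2 /\ f 1 = x%:C) ->
  (forall h : int, h != 0 ->
        let g := fun t : R => f t - t%:C * f 1 in
        complex.Re (fourier_coef g h) = 0 /\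
        `|fourier_coef g h| <= ((pi * `|h|%:~R)^-1)%:C) ->
  forall e : R, 0 < e -> exists L (y : int -> R), [/\ forall h, -2 <= y h <= 2,
     forall n, (L <= n)%N -> y (Posz n) = 0 /\ y (- Posz n) = 0,
     forall N, (L <= N)%N -> forall t, 0 <= t <= 1 -> `|complex.Re (f t) - reK N y t| <= e
   & forall N, (L <= N)%N -> forall t, 0 <= t <= 1 -> `|complex.Im (f t) - imK N y t| <= e].
Proof.
move=> c1 c2 f0 [x1 [x12 f1]].
pose g := fun t : R => f t - t%:C * f 1.
have g1E t : complex.Re (g t) = complex.Re (f t) - t * x1.
  by rewrite /g Re_sub f1 /= mul0r subr0.
have g2E t : complex.Im (g t) = complex.Im (f t).
  by rewrite /g Im_sub f1 /= mulr0 mul0r addr0 subr0.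
pose g1 t := complex.Re (g t); pose g2 t := complex.Im (g t).
have cg1 : c01 g1.
  rewrite (_ : g1 = (fun t => complex.Re (f t) - t * x1)); last exact/funext.
  apply: within01B => //.
  by apply: within01M; [exact: within01_id|exact: within01_const].
have cg2 : c01 g2 by rewrite (_ : g2 = (fun t => complex.Im (f t)))//; exact/funext.
move=> /(fourier_conditionP cg1 cg2) C e e0.
have e20 : 0 < e / 2 by rewrite divr_gt0.
have g10 : g1 0 = 0 by rewrite /g1 g1E f0 mul0r subr0.
have g11 : g1 1 = 0 by rewrite /g1 g1E f1 mul1r subrr.
have g20 : g2 0 = 0 by rewrite /g2 g2E f0.
have g21 : g2 1 = 0 by rewrite /g2 g2E f1.
have [N1 F1] := fejer_theorem cg1 (etrans g10 (esym g11)) e20.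
have [N2 F2] := fejer_theorem cg2 (etrans g20 (esym g21)) e20.
pose L := (maxn N1 N2).+1.
have L0 : 0 < L%:R :> R by [].
have NL1 : (N1 <= L)%N by rewrite ltnW// ltnS leq_maxl.
have NL2 : (N2 <= L)%N by rewrite ltnW// ltnS leq_maxr.
pose b n := sin_coef g1 n; pose c n := cos_coef g2 n.
pose wt n : R := if (n < L)%N then (1 - n%:R / L%:R) else 0.
have wt01 n : 0 <= wt n <= 1.
  rewrite /wt; case: ifPn => nL; last by rewrite lexx ler01.
  have : 0 <= n%:R / L%:R :> R by rewrite divr_ge0.
  have : n%:R / L%:R <= 1 :> R by rewrite ler_pdivrMr// mul1r ler_nat ltnW.
  by move=> ? ?; apply/andP; split; lra.
(* Here g^(n) = i (c n - b n) and g^(-n) = i (c n + b n), whence the signs of 2 i pi h g^(h); the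
   value at 0 is f(1). *)
pose y (h : int) : R := match h with
  | Posz 0 => x1
  | Posz n => - (wt n * (2 * pi * n%:R) * (c n - b n))
  | Negz k => wt k.+1 * (2 * pi * k.+1%:R) * (c k.+1 + b k.+1)
  end.
have yP n : (0 < n)%N -> y (Posz n) = - (wt n * (2 * pi * n%:R) * (c n - b n)) by case: n.
have yN n : (0 < n)%N -> y (- Posz n) = wt n * (2 * pi * n%:R) * (c n + b n) by case: n.
have bnd n (v : R) : (0 < n)%N -> `|v| <= (pi * n%:R)^-1 -> `|wt n * (2 * pi * n%:R) * v| <= 2.
  move=> n0 hv; have w0 := freq_gt0 R n0; have /andP[wt0 wt1] := wt01 n.
  rewrite normrM ger0_norm; last by rewrite mulr_ge0// ltW.
  have h : 2 * pi * n%:R * `|v| <= 2.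
    have p0 : 0 < pi * n%:R :> R by rewrite mulr_gt0 ?pi_gt0 ?ltr0n.
    by move: hv; rewrite -[_^-1]mul1r ler_pdivlMr// mulrC; lra.
  rewrite -(mulrA (wt n)); apply: le_trans (ler_piMl _ wt1) h.
  by rewrite mulr_ge0// ltW.
have wt_big n : (L <= n)%N -> wt n = 0 by rewrite /wt leqNgt => /negbTE ->.
have y_big n : (L <= n)%N -> y (Posz n) = 0 /\ y (- Posz n) = 0.
  move=> Ln; have n0 : (0 < n)%N by exact: leq_trans Ln.
  by rewrite yP// yN// wt_big// !mul0r oppr0.
exists L, y; split => //.
- case=> [[//|n]|n]; rewrite -ler_norml.
    by rewrite yP// normrN bnd//; have [] := C n.+1 isT.
  by rewrite NegzE yN// bnd//; have [] := C n.+1 isT.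
- move=> N LN t t01.
  (* Subtracting the value at 0 removes the zeroth coefficient, which the conditions leave free, and
     costs a second e/2 because [g1] vanishes at 0. *)
  have E : reK N y t = t * x1 + (fejer_mean L g1 t - fejer_mean L g1 0).
    rewrite /reK; congr (_ + _); rewrite (pair_sum_truncate _ _ _ y_big)//; last exact: leqW.
    rewrite /pair_sum /fejer_mean opprD addrACA subrr add0r -sumrB big_nat [in RHS]big_nat.
    apply: eq_bigr => n /andP[n0 nL]; have [a0 _ _ _] := C n n0.
    rewrite -/(cos_coef g1 n) in a0.
    rewrite yP// yN// /wt nL a0 !mul0r !add0r sinn0 mulr0 mulr0 subr0 /sin_basis -/(b n).
    have : 2 * pi * n%:R != 0 :> R by rewrite gt_eqF ?freq_gt0.
    by move: (1 - n%:R / L%:R) (2 * pi * n%:R) => q w w0; field.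
  have h1 := F1 L NL1 isT t t01; have h2 := F1 L NL1 isT 0.
  rewrite g10 subr0 in h2.
  have := h2 _; rewrite lexx ler01 => /(_ isT) {}h2.
  move: h1 h2; rewrite E /g1 g1E !ler_norml => /andP[k1 k2] /andP[k3 k4].
  by apply/andP; split; lra.
- move=> N LN t t01.
  (* The subtraction also turns cos into cos - 1, that is, into a multiple of [cos_basis]. *)
  have E : imK N y t = fejer_mean L g2 t - fejer_mean L g2 0.
    rewrite /imK (pair_sum_truncate _ _ _ y_big)//; last exact: leqW.
    rewrite /pair_sum /fejer_mean opprD addrACA subrr add0r -sumrB big_nat [in RHS]big_nat.
    apply: eq_bigr => n /andP[n0 nL]; have [_ a0 _ _] := C n n0.
    rewrite -/(sin_coef g2 n) in a0.
    rewrite yP// yN// /wt nL a0 !mul0r !addr0 cosn0 /cos_basis -/(c n).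
    have : 2 * pi * n%:R != 0 :> R by rewrite gt_eqF ?freq_gt0.
    by move: (1 - n%:R / L%:R) (2 * pi * n%:R) => q w w0; field.
  have h1 := F2 L NL2 isT t t01; have h2 := F2 L NL2 isT 0.
  rewrite g20 subr0 in h2.
  have := h2 _; rewrite lexx ler01 => /(_ isT) {}h2.
  move: h1 h2; rewrite E /g2 g2E !ler_norml => /andP[k1 k2] /andP[k3 k4].
  by apply/andP; split; lra.
Qed.

End fourier.

(** * Random tails *)

Section basis_bounds.
Context (R : realType).
Implicit Types (t s : R) (n : nat).

Lemma freq_ge n : (0 < n)%N -> 2 * n%:R <= 2 * pi * n%:R :> R.
Proof.
move=> n0; rewrite ler_wpM2r//; have := @pi_ge2 R; lra.
Qed.

Lemma sin_basis_le n t : (0 < n)%N -> `|sin_basis n t| <= n%:R^-1.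
Proof.
move=> n0; have w0 := freq_gt0 R n0; have wn := freq_ge n0.
have n0' : 0 < n%:R :> R by rewrite ltr0n.
rewrite normrM [X in _ * X]gtr0_norm ?invr_gt0// ler_pdivrMr//.
apply: le_trans (sin_max _) _; rewrite mulrC ler_pdivlMr// mul1r; lra.
Qed.

Lemma cos_basis_le n t : (0 < n)%N -> `|cos_basis n t| <= n%:R^-1.
Proof.
move=> n0; have w0 := freq_gt0 R n0; have wn := freq_ge n0.
have n0' : 0 < n%:R :> R by rewrite ltr0n.
rewrite normrM [X in _ * X]gtr0_norm ?invr_gt0// ler_pdivrMr//.
apply: (@le_trans _ _ 2).
  have h1 := cos_le1 (phase n t); have h2 := cos_geN1 (phase n t).
  by rewrite ler_norml /cosn; apply/andP; split; lra.
by rewrite mulrC ler_pdivlMr.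
Qed.

Lemma derive_lipschitz (u du : R -> R) : (forall t, is_derive t 1 u (du t)) ->
  (forall t, `|du t| <= 1) -> forall t s, `|u t - u s| <= `|t - s|.
Proof.
move=> d b; have cu : continuous u.
  by move=> t; apply: differentiable_continuous; apply/derivable1_diffP.
suff h t s : s <= t -> `|u t - u s| <= `|t - s|.
  move=> t s; have [/h//|/ltW/h] := leP s t.
  by rewrite distrC (distrC s).
move=> st; have [c _ ->] := MVT_segment st (fun x _ => d x) (continuous_subspaceT cu).
by rewrite normrM ler_piMl.
Qed.

Lemma sin_basis_lipschitz n t s : (0 < n)%N -> `|sin_basis n t - sin_basis n s| <= `|t - s|.
Proof.
move=> n0; have w0 := freq_gt0 R n0.
apply: (@derive_lipschitz _ (cosn n)) => x; last exact: cos_max.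
have -> : sin_basis n = (2 * pi * n%:R)^-1 \*: (@sinn R n).
  by apply/funext => y; rewrite /sin_basis mulrC.
apply: is_derive_eq (is_deriveZ _ (is_derive_sinn n x)) _.
by rewrite /GRing.scale/= mulKf// gt_eqF.
Qed.

Lemma cos_basis_lipschitz n t s : (0 < n)%N -> `|cos_basis n t - cos_basis n s| <= `|t - s|.
Proof.
move=> n0; have w0 := freq_gt0 R n0.
pose c : R := - (2 * pi * n%:R)^-1; pose u := c \*: (@cosn R n).
have -> : cos_basis n t - cos_basis n s = u t - u s.
  by rewrite (_ : u t = c * cosn n t)// (_ : u s = c * cosn n s)// /cos_basis /c; ring.
apply: (@derive_lipschitz _ (sinn n)) => x; last exact: sin_max.
apply: is_derive_eq (is_deriveZ _ (is_derive_cosn n x)) _.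
by rewrite /GRing.scale/= /c !mulNr mulrN opprK mulKf// gt_eqF.
Qed.

End basis_bounds.

(** Tenth power of x / 10 <= expR (x / 10). The exponent is one more than the growth q^9 of the
    number of bad points in a block. *)
Lemma expR_ge_exp10 (R : realType) (x : R) : 0 <= x -> x ^+ 10 <= 10 ^+ 10 * expR x.
Proof.
move=> x0; have -> : expR x = expR (x / 10) ^+ 10.
  by rewrite -expRM_natl; congr expR; lra.
rewrite -exprMn lerXn2r ?nnegrE ?mulr_ge0 ?expR_ge0//.
have := expR_ge1Dx (x / 10); lra.
Qed.

(** Union bound for a block with q = 2^m: 16 q^4 + 1 <= 17 q^4 partial sums, q^5 + 1 <= 2 q^5 grid
    points and two signs give 17 * 2 * 2 = 68. [E] stands for exp(256), [x] for exp(q), [F] for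
    10^10. *)
Lemma bad_count_le (R : realType) (p q E F x : R) :
  0 <= p -> 1 <= q -> 0 < E -> 0 < F -> 0 < x -> q ^+ 10 <= F * x ->
  (16 * q ^+ 4 + 1) * ((q ^+ 5 + 1) * (p * (E * x^-1) + p * (E * x^-1))) <=
  p * (68 * E * F / q).
Proof.
move=> p0 q1 E0 F0 x0 hx.
have q0 : 0 < q by exact: lt_le_trans q1.
have hx' : x^-1 <= F / q ^+ 10.
  by rewrite -[F / _]invf_div lef_pV2 ?posrE ?divr_gt0 ?exprn_gt0// ler_pdivrMr// mulrC.
have q4 : 1 <= q ^+ 4 by rewrite exprn_ege1.
have q5 : 1 <= q ^+ 5 by rewrite exprn_ege1.
have -> : p * (68 * E * F / q) = (17 * q ^+ 4) * ((2 * q ^+ 5) *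
    (p * (E * (F / q ^+ 10)) + p * (E * (F / q ^+ 10)))).
  by field; rewrite gt_eqF.
have k1 : 16 * q ^+ 4 + 1 <= 17 * q ^+ 4 by move: (q ^+ 4) q4 => y; lra.
have k2 : q ^+ 5 + 1 <= 2 * q ^+ 5 by move: (q ^+ 5) q5 => y; lra.
have k3 : p * (E * x^-1) <= p * (E * (F / q ^+ 10)).
  by rewrite ler_wpM2l// ler_wpM2l// ltW.
have z1 : 0 <= p * (E * x^-1) by rewrite !mulr_ge0// ?invr_ge0 ltW.
have z2 : 0 <= q ^+ 4 by exact: le_trans q4.
have z3 : 0 <= q ^+ 5 by exact: le_trans q5.
apply: ler_pM => //.
- by rewrite addr_ge0// mulr_ge0.
- by rewrite mulr_ge0// addr_ge0.
apply: ler_pM => //.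
- by rewrite addr_ge0.
- by rewrite addr_ge0.
exact: lerD.
Qed.

Section tail.
Context (R : realType) (b : nat -> R -> R) (sg : R).
Hypothesis b_le : forall n t, (0 < n)%N -> `|b n t| <= n%:R^-1.
Hypothesis b_lip : forall n t s, (0 < n)%N -> `|b n t - b n s| <= `|t - s|.
Hypothesis sg1 : `|sg| = 1.

(** Stated for a fixed sequence of coefficients, so that the passage from blocks to tails is
    deterministic. For [N] at most [16 ^ m] the sum is empty. *)
Definition good_block (x : int -> R) (m : nat) := forall N k : nat,
  (N <= 16 ^ m.+1)%N -> (k <= 32 ^ m)%N ->
  `|pair_sum b sg x (16 ^ m) N (k%:R / (32 ^ m)%:R)| <= (2 ^ m)%:R^-1.

Lemma pair_coef_le x n : (forall h : int, `|x h| <= 2) ->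
  `|x (Posz n) + sg * x (- Posz n)| <= 4.
Proof.
move=> x2; apply: le_trans (ler_normD _ _) _; rewrite normrM sg1 mul1r.
by have := x2 (Posz n); have := x2 (- Posz n); lra.
Qed.

(** Moving to the nearby grid point changes each of the at most 16 * 16^m terms by at most 4 *
    32^-m, in total 64 / 2^m; the grid value adds 1 / 2^m. *)
Lemma block_bound x m N t : (forall h : int, `|x h| <= 2) -> good_block x m ->
  (16 ^ m <= N <= 16 ^ m.+1)%N -> 0 <= t <= 1 ->
  `|pair_sum b sg x (16 ^ m) N t| <= 65 / (2 ^ m)%:R.
Proof.
move=> x2 good /andP[mN Nm] t01.
have D0 : (0 < 32 ^ m)%N by rewrite expn_gt0.
have [k kD hk] := grid_approx (32 ^ m).-1 t01; rewrite prednK// in kD hk.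
have h1 := good N k Nm kD.
set s := k%:R / (32 ^ m)%:R in h1 hk.
have h2 : `|pair_sum b sg x (16 ^ m) N t - pair_sum b sg x (16 ^ m) N s| <= 64 / (2 ^ m)%:R.
  rewrite /pair_sum -sumrB.
  apply: le_trans (ler_norm_sum _ _ _) _.
  apply: (@le_trans _ _ (\sum_(16 ^ m <= n < N) (32 ^ m)%:R^-1 * 4)).
    rewrite big_nat [X in _ <= X]big_nat; apply: ler_sum => n /andP[n0 _].
    have n0' : (0 < n)%N by apply: leq_trans n0; rewrite expn_gt0.
    rewrite -mulrBl normrM ler_pM//; last exact: pair_coef_le.
    exact: le_trans (b_lip _ _ n0') hk.
  rewrite sumr_const_nat -[_ *+ _]mulr_natr.
  have q0 : 0 < (2 ^ m)%:R :> R by rewrite ltr0n expn_gt0.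
  have E32 : (32 ^ m)%:R = (2 ^ m)%:R ^+ 5 :> R by rewrite -natrX -expnM mulnC expnM.
  have : ((N - 16 ^ m)%:R : R) <= 16 * (2 ^ m)%:R ^+ 4.
    rewrite -natrX -expnM mulnC expnM -natrM ler_nat -expnS.
    exact: leq_trans (leq_subr _ _) Nm.
  rewrite E32; move: (2 ^ m)%:R q0 => q q0 hN.
  rewrite ler_pdivlMr//.
  have -> : 64 = (q ^+ 5)^-1 * 4 * (16 * q ^+ 4) * q by field; rewrite gt_eqF.
  by rewrite ler_pM2r// ler_wpM2l// mulr_ge0// invr_ge0 exprn_ge0// ltW.
have := ler_distD (pair_sum b sg x (16 ^ m) N s) (pair_sum b sg x (16 ^ m) N t) 0.
rewrite !subr0 => /le_trans; apply.
have := lerD h2 h1; move/le_trans; apply.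
by rewrite -[X in _ + X]mul1r -mulrDl ler_pM2r ?invr_gt0 ?ltr0n ?expn_gt0//; lra.
Qed.

Lemma tail_bound x m0 t : (forall h : int, `|x h| <= 2) ->
  (forall m, (m0 <= m)%N -> good_block x m) -> 0 <= t <= 1 ->
  forall m N, (m0 <= m)%N -> (16 ^ m <= N)%N ->
  `|pair_sum b sg x (16 ^ m) N t| <= 130 / (2 ^ m)%:R.
Proof.
move=> x2 good t01.
(* Induction on the number of blocks; the constant reproduces itself because 65 / 2^m + 130 /
   2^(m+1) = 130 / 2^m. *)
suff H j : forall m N, (m0 <= m)%N -> (16 ^ m <= N)%N -> (N <= 16 ^ (m + j))%N ->
    `|pair_sum b sg x (16 ^ m) N t| <= 130 / (2 ^ m)%:R.
  move=> m N m0m mN; apply: (H N) => //.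
  by apply: leq_trans (ltnW (@ltn_expl 16 N isT)) _; rewrite leq_exp2l// leq_addl.
have q0 (i : nat) : 0 < (2 ^ i)%:R^-1 :> R by rewrite invr_gt0 ltr0n expn_gt0.
elim: j => [|j IH] m N m0m mN Nm.
  rewrite addn0 in Nm; rewrite /pair_sum big_geq// normr0.
  by rewrite mulr_ge0// ltW.
have [Nm1|Nm1] := leqP N (16 ^ m.+1).
  apply: le_trans (block_bound x2 (good _ m0m) _ t01) _; first by rewrite mN.
  by rewrite ler_pM2r//; lra.
have m16 : (16 ^ m <= 16 ^ m.+1)%N by rewrite leq_exp2l.
have -> : pair_sum b sg x (16 ^ m) N t =
    pair_sum b sg x (16 ^ m) (16 ^ m.+1) t + pair_sum b sg x (16 ^ m.+1) N t.
  by rewrite /pair_sum -big_cat_nat// ltnW.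
apply: le_trans (ler_normD _ _) _.
have h1 := block_bound x2 (good _ m0m) (N := 16 ^ m.+1) (t := t).
rewrite m16 leqnn in h1; have {}h1 := h1 isT t01.
have := IH m.+1 N (leqW m0m) (ltnW Nm1); rewrite addSnnS => /(_ Nm) h2.
apply: le_trans (lerD h1 h2) _.
rewrite expnS natrM invfM; have := q0 m; move: ((2 ^ m)%:R^-1) => q hq; lra.
Qed.

Context d (T : measurableType d) (P : probability T R) (X : int -> T -> R).
Hypothesis mX : forall h, measurable_fun setT (X h).
Hypothesis indepX : mutually_independent P X.
Hypothesis lawX : forall h, sato_tate_law P (X h).

Definition sym_range (a c : nat) : seq int :=
  [seq Posz n | n <- index_iota a c] ++ [seq - Posz n | n <- index_iota a c].

Lemma mem_sym_range a c h : h \in sym_range a c -> (a <= `|h| < c)%N.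
Proof.
rewrite mem_cat => /orP[] /mapP[n + ->]; rewrite mem_index_iota ?abszN; exact.
Qed.

Lemma sym_range_uniq a c : (0 < a)%N -> uniq (sym_range a c).
Proof.
move=> a0; rewrite cat_uniq !map_inj_uniq ?iota_uniq ?andbT/=; last 2 first.
- by move=> x y /oppr_inj [].
- by move=> x y [].
apply/hasPn => h /mapP[n]; rewrite mem_index_iota => /andP[an _] ->.
apply/negP => /mapP[k _]; lia.
Qed.

Lemma size_sym_range a c : size (sym_range a c) = (2 * (c - a))%N.
Proof. by rewrite size_cat !size_map size_iota mul2n addnn. Qed.

(** The sign [sn] reduces a bound on an absolute value to two one-sided Chernoff bounds. The indices
    in [H] lie below the block, hence are disjoint from those of the sum. *)
Lemma half_bad_point_prob (sn : R) (m N : nat) (t : R) (H : seq int) (B : int -> set R) :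
  `|sn| = 1 -> (0 < m)%N -> (N <= 16 ^ m.+1)%N ->
  uniq H -> (forall h, h \in H -> (`|h| < 16 ^ m)%N) -> (forall h, measurable (B h)) ->
  (P ((\big[setI/setT]_(j <- H) (X j @^-1` B j)) `&`
      [set w | ((2 ^ m)%:R^-1 <= sn * pair_sum b sg (X^~ w) (16 ^ m) N t)%R]) <=
   P (\big[setI/setT]_(j <- H) (X j @^-1` B j)) * (expR (256 - (2 ^ m)%:R))%:E)%E.
Proof.
move=> sn1 m0 Nm uH Hm mB.
pose J := sym_range (16 ^ m) N.
pose a (h : int) := sn * match h with Posz n => b n t | Negz k => sg * b k.+1 t end.
have M0 : (0 < 16 ^ m)%N by rewrite expn_gt0.
have aN n : (0 < n)%N -> a (- Posz n) = sn * (sg * b n t) by case: n.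
have sumE w : \sum_(j <- J) a j * X j w = sn * pair_sum b sg (X^~ w) (16 ^ m) N t.
  rewrite /J /sym_range big_cat !big_map /= -big_split/= /pair_sum mulr_sumr.
  rewrite big_nat [in RHS]big_nat; apply: eq_bigr => n /andP[n0 _].
  have n0' : (0 < n)%N by apply: leq_trans n0.
  by rewrite aN// /a; ring.
have ale j : j \in J -> `|a j| <= (16 ^ m)%:R^-1.
  move=> /mem_sym_range/andP[mj _].
  have j0 : (0 < `|j|)%N by apply: leq_trans mj.
  apply: (@le_trans _ _ (`|j|%N%:R^-1)); last first.
    by rewrite lef_pV2 ?posrE ?ltr0n// ler_nat.
  rewrite /a normrM sn1 mul1r; case: j j0 {mj} => [n|n] j0; first exact: b_le.
  by rewrite normrM sg1 mul1r; exact: b_le.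
have uHJ : uniq (H ++ J).
  rewrite cat_uniq uH sym_range_uniq// andbT/=.
  apply/hasPn => h /mem_sym_range/andP[mh _].
  by apply/negP => /Hm; rewrite ltnNge mh.
(* This s makes s / 2^m equal to 2^m while 8 s^2 sum_j a_j^2 stays bounded. *)
pose s : R := (4 ^ m)%:R.
have q1 : 2 <= (2 ^ m)%:R :> R by rewrite ler_nat -{1}(expn1 2) leq_exp2l.
have q0 : 0 < (2 ^ m)%:R :> R by rewrite ltr0n expn_gt0.
have E4 : (4 ^ m)%:R = (2 ^ m)%:R ^+ 2 :> R by rewrite -natrX -expnM mulnC expnM.
have E16 : (16 ^ m)%:R = (2 ^ m)%:R ^+ 4 :> R by rewrite -natrX -expnM mulnC expnM.
have s0 : 0 <= s by [].
have sa j : j \in J -> `|s * a j| <= 4^-1.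
  move=> /ale aj; rewrite normrM ger0_norm//; apply: le_trans (ler_wpM2l s0 aj) _.
  rewrite /s E4 E16; move: (2 ^ m)%:R q1 q0 => q q1 q0.
  rewrite (_ : q ^+ 2 / q ^+ 4 = (q ^+ 2)^-1); last by field; rewrite gt_eqF.
  by rewrite lef_pV2 ?posrE ?exprn_gt0//; nra.
have := cylinder_chernoff mX indepX (2 ^ m)%:R^-1 lawX uHJ mB s0 sa.
under [X in (P (_ `&` X) <= _)%E -> _]eq_set do rewrite sumE.
move=> /le_trans; apply.
apply: lee_wpmul2l; first exact: measure_ge0.
rewrite lee_fin ler_expR.
(* There are 2 (N - 16^m), hence at most 32 * 16^m, coefficients, each at most 16^-m in absolute
   value. *)
have a2 : \sum_(j <- J) a j ^+ 2 <= 32 * (16 ^ m)%:R * (16 ^ m)%:R ^- 2.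
  apply: (@le_trans _ _ (\sum_(j <- J) (16 ^ m)%:R ^- 2)).
    rewrite big_seq [X in _ <= X]big_seq; apply: ler_sum => j /ale aj.
    by rewrite -real_normK ?num_real// -exprVn lerXn2r ?nnegrE// invr_ge0.
  rewrite big_const_seq count_predT iter_addr_0 size_sym_range -[_ *+ _]mulr_natr mulrC.
  rewrite ler_wpM2r ?invr_ge0 ?exprn_ge0// -natrM ler_nat.
  have : (N - 16 ^ m <= 16 * 16 ^ m)%N by rewrite -expnS; exact: leq_trans (leq_subr _ _) Nm.
  by lia.
rewrite lerB//.
  apply: (@le_trans _ _ (8 * s ^+ 2 * (32 * (16 ^ m)%:R * (16 ^ m)%:R ^- 2))).
    by rewrite ler_wpM2l// mulr_ge0// exprn_ge0.
  rewrite /s E4 E16; move: (2 ^ m)%:R q0 => q q0.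
  rewrite (_ : 8 * (q ^+ 2) ^+ 2 * (32 * q ^+ 4 * (q ^+ 4) ^- 2) = 256)//.
  by field; rewrite gt_eqF.
rewrite /s E4; move: (2 ^ m)%:R q0 => q q0.
by rewrite expr2 mulfK// gt_eqF.
Qed.

Lemma bigsetU_prob_le (A : set T) (F : nat -> set T) (c : R) (n : nat) :
  measurable A -> (forall i, (i < n)%N -> measurable (F i)) ->
  (forall i, (i < n)%N -> P (A `&` F i) <= c%:E)%E ->
  (P (A `&` \big[setU/set0]_(i < n) F i) <= (n%:R * c)%:E)%E.
Proof.
move=> mA; elim: n => [|n IH] mF h.
  by rewrite big_ord0 setI0 measure0 mul0r.
rewrite big_ord_recr/= setIUr.
have mU : measurable (\big[setU/set0]_(i < n) F i).
  by apply: bigsetU_measurable => i _; apply: mF; rewrite ltnW// ltnS.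
apply: le_trans (measureU2 _ _ _) _; [exact: measurableI|apply: measurableI => //; exact: mF|].
rewrite -natr1 mulrDl mul1r EFinD leeD//; last exact: h.
by apply: IH => i ni; [apply: mF|apply: h]; exact: ltnW.
Qed.

Definition bad_point (m N k : nat) : set T :=
  [set w | (2 ^ m)%:R^-1 <=
     1 * pair_sum b sg (X^~ w) (16 ^ m) N (k%:R / (32 ^ m)%:R)] `|`
  [set w | (2 ^ m)%:R^-1 <=
     -1 * pair_sum b sg (X^~ w) (16 ^ m) N (k%:R / (32 ^ m)%:R)].

Definition bad_block (m : nat) : set T :=
  \big[setU/set0]_(N < (16 ^ m.+1).+1) \big[setU/set0]_(k < (32 ^ m).+1)
    bad_point m N k.

Lemma half_bad_point_measurable (sn l : R) m n t :
  measurable [set w | l <= sn * pair_sum b sg (X^~ w) m n t].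
Proof.
have mf : measurable_fun setT (fun w => sn * pair_sum b sg (X^~ w) m n t).
  by apply: measurable_funM; [exact: measurable_cst|exact: measurable_pair_sum].
rewrite -[X in measurable X]setTI (_ : [set w | _] =
  (fun w => sn * pair_sum b sg (X^~ w) m n t) @^-1` `[l, +oo[); first exact: mf.
by apply/seteqP; split => w /=; rewrite in_itv/= andbT.
Qed.

Lemma bad_point_measurable m N k : measurable (bad_point m N k).
Proof. by apply: measurableU; exact: half_bad_point_measurable. Qed.

Lemma bad_block_measurable m : measurable (bad_block m).
Proof.
apply: bigsetU_measurable => N _; apply: bigsetU_measurable => k _.
exact: bad_point_measurable.
Qed.

Lemma good_blockP m w : ~ bad_block m w -> good_block (X^~ w) m.
Proof.
move=> nb N k Nm km; rewrite leNgt; apply/negP => h; apply: nb.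
rewrite /bad_block (bigD1 (inord N))//=; left.
rewrite (bigD1 (inord k))//=; left; rewrite !inordK ?ltnS//.
move: h; rewrite /bad_point; set z := pair_sum _ _ _ _ _ _; move=> h.
have [z0|z0] := leP 0 z; [left|right] => /=.
  by rewrite -/z mul1r ltW// -[z]ger0_norm.
by rewrite -/z mulN1r ltW// -ltr0_norm.
Qed.

(* With q = 2^m, a block has at most 68 q^9 bad points, each of probability at
   most exp(256 - q), and q^10 <= 10^10 exp(q). *)
Definition bad_const : R := 68 * expR 256 * 10 ^+ 10.

Lemma bad_const_gt0 : 0 < bad_const.
Proof. by rewrite /bad_const !mulr_gt0 ?expR_gt0// exprn_gt0. Qed.

Lemma bad_block_prob m (H : seq int) (B : int -> set R) : (0 < m)%N ->
  uniq H -> (forall h, h \in H -> (`|h| < 16 ^ m)%N) ->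
  (forall h, measurable (B h)) ->
  (P ((\big[setI/setT]_(j <- H) (X j @^-1` B j)) `&` bad_block m) <=
   (fine (P (\big[setI/setT]_(j <- H) (X j @^-1` B j))) *
    (bad_const / (2 ^ m)%:R))%:E)%E.
Proof.
move=> m0 uH Hm mB; set A := \big[setI/setT]_(j <- H) (X j @^-1` B j).
have mA : measurable A by exact: (cylinder_measurable mX).
have PA : P A = (fine (P A))%:E by rewrite fineK// fin_num_measure.
have PA0 : 0 <= fine (P A) by rewrite fine_ge0.
pose e := fine (P A) * expR (256 - (2 ^ m)%:R).
have h N k : (N < (16 ^ m.+1).+1)%N -> (P (A `&` bad_point m N k) <= (e + e)%:E)%E.
  move=> Nm; rewrite setIUr; apply: le_trans (measureU2 _ _ _) _;
    [apply: measurableI => //; exact: half_bad_point_measurable..|].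
  rewrite EFinD /e EFinM -PA; apply: leeD; apply: half_bad_point_prob => //.
    exact: normr1.
  by rewrite normrN normr1.
have h1 N : (N < (16 ^ m.+1).+1)%N ->
    (P (A `&` \big[setU/set0]_(k < (32 ^ m).+1) bad_point m N k) <=
     ((32 ^ m).+1%:R * (e + e))%:E)%E.
  move=> Nm; apply: (@bigsetU_prob_le A (bad_point m N)) => // i _.
    exact: bad_point_measurable.
  exact: h.
have h2 : (P (A `&` bad_block m) <=
    ((16 ^ m.+1).+1%:R * ((32 ^ m).+1%:R * (e + e)))%:E)%E.
  apply: (@bigsetU_prob_le A (fun N =>
    \big[setU/set0]_(k < (32 ^ m).+1) bad_point m N k)) => // i _.
  by apply: bigsetU_measurable => k _; exact: bad_point_measurable.
apply: le_trans h2 _; rewrite lee_fin /e /bad_const.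
have q1 : 1 <= (2 ^ m)%:R :> R by rewrite ler1n expn_gt0.
have E16 : (16 ^ m.+1)%:R = 16 * (2 ^ m)%:R ^+ 4 :> R.
  by rewrite expnS natrM -natrX -expnM mulnC expnM.
have E32 : (32 ^ m)%:R = (2 ^ m)%:R ^+ 5 :> R by rewrite -natrX -expnM mulnC expnM.
rewrite -(natr1 (16 ^ m.+1)) -(natr1 (32 ^ m)) E16 E32 expRD expRN.
have hx := expR_ge_exp10 (le_trans ler01 q1).
by apply: bad_count_le.
Qed.

End tail.

(** * The support *)

Lemma within01_complex (R : realType) (f : R -> R[i]) :
  {within `[0%R, 1%R], continuous (f : R -> (R[i])^o)} ->
  {within `[0%R, 1%R], continuous (fun t => complex.Re (f t) : R)} /\
  {within `[0%R, 1%R], continuous (fun t => complex.Im (f t) : R)}.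
Proof.
move=> /subspace_continuousP cf.
have H t : 0 <= t <= 1 -> forall e : R, 0 < e -> exists2 r : R, 0 < r &
    forall y, 0 <= y <= 1 -> `|t - y| < r -> cabs (f t - f y) < e.
  move=> t01 e e0.
  have /cf/cvgrPdist_lt/(_ e%:C) : (`[0%R, 1%R]%classic : set R) t by rewrite /= in_itv.
  rewrite ltcR => /(_ e0); rewrite near_withinE => /nbhs_ballP[r /= r0 h].
  exists r => // y y01 ty; rewrite -ltcR -normc_cabs; apply: h; rewrite /= ?in_itv//.
split; apply/within01P => t t01 e e0; have [r r0 h] := H _ t01 _ e0;
  exists r => // y y01 /(h _ y01).
  by rewrite -Re_sub; apply: le_lt_trans; exact: Re_le_cabs.
by rewrite -Im_sub; apply: le_lt_trans; exact: Im_le_cabs.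
Qed.

Section support.
Context d (T : measurableType d) (R : realType) (P : probability T R).
Context (ST : int -> T -> R).
Hypothesis mST : forall h, measurable_fun setT (ST h).
Hypothesis indST : mutually_independent P ST.
Hypothesis lawST : forall h, sato_tate_law P (ST h).
Local Notation c01 u := ({within `[0%R, 1%R], continuous (u : R -> R)}).

(** A null event outside of which every variable lies in [-2, 2]; the two constructors of [int] make
    it a union over [nat]. *)
Definition unbounded_set : set T :=
  \bigcup_n (~` [set w | `|ST (Posz n) w| <= 2] `|` ~` [set w | `|ST (Negz n) w| <= 2]).

Lemma bounded_measurable h : measurable [set w | `|ST h w| <= 2].
Proof.
rewrite -[X in measurable X]setTI (_ : [set w | _] = ST h @^-1` `[-2, 2]); first exact: mST.
by apply/seteqP; split => w /=; rewrite in_itv/= ler_norml.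
Qed.

Lemma unbounded_set_measurable : measurable unbounded_set.
Proof.
by apply: bigcupT_measurable => n; apply: measurableU;
  apply: measurableC; exact: bounded_measurable.
Qed.

Lemma unbounded_set_prob : P unbounded_set = 0%E.
Proof.
have P0 h : P (~` [set w | (`|ST h w| <= 2)%R]) = 0%E.
  by rewrite probability_setC ?sato_tate_support ?subee//; exact: bounded_measurable.
apply/eqP; rewrite eq_le measure_ge0 andbT.
have mF n : measurable (~` [set w | `|ST (Posz n) w| <= 2] `|` ~` [set w | `|ST (Negz n) w| <= 2]).
  by apply: measurableU; apply: measurableC; exact: bounded_measurable.
apply: le_trans (measure_sigma_subadditive P mF unbounded_set_measurable _) _ => //.
rewrite eseries0// => n _ _; apply/eqP; rewrite eq_le measure_ge0 andbT.
apply: le_trans (measureU2 _ _ _) _; [by apply: measurableC; exact: bounded_measurable..|].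
have P0' h : (P (~` [set w | (`|ST h w| <= 2)%R]) <= 0)%E by rewrite P0.
by rewrite -[X in (_ <= X)%E]adde0; exact: leeD (P0' _) (P0' _).
Qed.

Lemma unbounded_setN w : ~ unbounded_set w -> forall h, `|ST h w| <= 2.
Proof.
move=> nw; case=> n; apply: contrapT => h; apply: nw; exists n => //; [left|right]; exact: h.
Qed.

(** An event of positive probability is not contained in the null event [unbounded_set], so some
    sample point provides partial sums close to [f] with all coefficients in [-2, 2]. *)
Lemma support_subset (f : R -> R[i]) :
  c01 (fun t => complex.Re (f t)) -> c01 (fun t => complex.Im (f t)) ->
  in_support_K P ST f ->
  [/\ f 0 = 0,
      exists x : R, -2 <= x <= 2 /\ f 1 = x%:C
    & forall h : int, h != 0 ->
        let g := fun t : R => f t - t%:C * f 1 in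
        complex.Re (fourier_coef g h) = 0 /\
        `|fourier_coef g h| <= ((pi * `|h|%:~R)^-1)%:C].
Proof.
move=> c1 c2 S; apply: support_necessary => // e e0 N0.
have e20 : 0 < e / 2 by rewrite divr_gt0.
have := S _ e20; set E := [set w | _] => PE.
have mE : measurable E by exact: support_event_measurable.
have [w [[k [Kk kf]] nw]] : exists w, E w /\ ~ unbounded_set w.
  apply: contrapT => /forallNP h.
  have : (P E <= P unbounded_set)%E.
    apply: le_measure; rewrite ?inE//; first exact: unbounded_set_measurable.
    by move=> w Ew; apply: contrapT => nw; exact: (h w).
  by rewrite unbounded_set_prob leNgt PE.
have [N1 hN] := Kk _ e20.
exists (maxn N0 N1), (ST^~ w).
have D t : 0 <= t <= 1 -> cabs (f t - K_partial ST (maxn N0 N1) w t) <= e.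
  move=> t01; have tI : t \in `[0%R, 1%R] by rewrite in_itv.
  have := hN _ (leq_maxr N0 N1) _ tI; have := kf _ tI.
  rewrite !normc_cabs !ltcR => h1 h2.
  apply: le_trans (cabs_distD (k t) _ _) _.
  by rewrite (cabs_distC (f t)) (cabs_distC (k t) (K_partial _ _ _ _)); lra.
split; first exact: leq_maxl.
- exact: unbounded_setN.
- move=> t /D; apply: le_trans; apply: le_trans (Re_le_cabs _).
  by rewrite Re_sub K_partialE.
- move=> t /D; apply: le_trans; apply: le_trans (Im_le_cabs _).
  by rewrite Im_sub K_partialE.
Qed.

Definition bad_tail (m0 : nat) : set T :=
  \bigcup_i (bad_block (@sin_basis R) 1 ST (m0 + i) `|`
             bad_block (@cos_basis R) (-1) ST (m0 + i)).

Lemma bad_tail_measurable m0 : measurable (bad_tail m0).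
Proof.
apply: bigcupT_measurable => i; apply: measurableU; exact: bad_block_measurable.
Qed.

Lemma bad_tail_prob m0 (H : seq int) (B : int -> set R) : (0 < m0)%N ->
  8 * bad_const R <= (2 ^ m0)%:R ->
  uniq H -> (forall h, h \in H -> (`|h| < 16 ^ m0)%N) -> (forall h, measurable (B h)) ->
  (P ((\big[setI/setT]_(j <- H) (ST j @^-1` B j)) `&` bad_tail m0) <=
   (fine (P (\big[setI/setT]_(j <- H) (ST j @^-1` B j))) / 2)%:E)%E.
Proof.
move=> m00 hC uH Hm mB; set A := \big[setI/setT]_(j <- H) _.
have mA : measurable A by exact: (cylinder_measurable mST).
set p := fine (P A); have p0 : 0 <= p by rewrite fine_ge0.
have C0 := bad_const_gt0 R.
pose F i := A `&` (bad_block (@sin_basis R) 1 ST (m0 + i) `|`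
             bad_block (@cos_basis R) (-1) ST (m0 + i)).
have mF i : measurable (F i).
  by apply: measurableI => //; apply: measurableU; exact: bad_block_measurable.
have mAB : measurable (A `&` bad_tail m0).
  by apply: measurableI => //; exact: bad_tail_measurable.
apply: le_trans (measure_sigma_subadditive P mF mAB _) _.
  by rewrite /F -setI_bigcupr.
have q0 : 0 < (2 ^ m0)%:R :> R by rewrite ltr0n expn_gt0.
(* The real and imaginary blocks of index m0 + i cost 2 p C / 2^(m0 + i) = e / 2^(i+1), where C is
   [bad_const]; these sum to [e], and 8 C <= 2^m0 gives e <= p / 2. *)
pose e := p * (4 * bad_const R / (2 ^ m0)%:R).
have e0 : 0 <= e by rewrite mulr_ge0// divr_ge0// mulr_ge0// ltW.
apply: le_trans (_ : e%:E <= _)%E; last first.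
  rewrite lee_fin /e ler_wpM2l// ler_pdivrMr//; lra.
apply: le_trans (epsilon_trick0 xpredT e0).
apply: lee_nneseries => [//|i _].
rewrite /F setIUr.
apply: le_trans (measureU2 _ _ _) _; [by apply: measurableI => //; exact: bad_block_measurable..|].
have Hm' h : h \in H -> (`|h| < 16 ^ (m0 + i))%N.
  by move=> /Hm /leq_trans; apply; rewrite leq_exp2l// leq_addr.
have m00' : (0 < m0 + i)%N by rewrite addn_gt0 m00.
have n1 : `|1 : R| = 1 by exact: normr1.
have n2 : `|-1 : R| = 1 by rewrite normrN normr1.
have h1 := bad_block_prob (@sin_basis_le R) n1 mST indST lawST m00' uH Hm' mB.
have h2 := bad_block_prob (@cos_basis_le R) n2 mST indST lawST m00' uH Hm' mB.
apply: le_trans (leeD h1 h2) _; rewrite -EFinD lee_fin -/A -/p /e.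
rewrite expnD expnS !natrM le_eqVlt; apply/orP; left; apply/eqP.
have : (2 ^ i)%:R != 0 :> R by rewrite pnatr_eq0 expn_eq0.
move: (2 ^ i)%:R (2 ^ m0)%:R q0 (bad_const R) => a c c0 C a0.
by field; rewrite a0 gt_eqF.
Qed.

(** The cylinder A of prescribed low frequencies has positive probability by independence. Removing
    the bad tail and the null event cannot exhaust it, for that would give P(A) <= P(A) / 2. The
    condition on [m0] involves neither [y] nor [dl], so [dl] may be chosen after [m0]. *)
Lemma prescribed_prob_gt0 m0 (y : int -> R) (dl : R) : (0 < m0)%N ->
  8 * bad_const R <= (2 ^ m0)%:R -> (forall h, -2 <= y h <= 2) -> 0 < dl ->
  exists2 G : set T, measurable G /\ (0 < P G)%E &
  forall w, G w -> [/\ forall h, `|ST h w| <= 2,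
    forall h : int, (`|h| < 16 ^ m0)%N -> `|ST h w - y h| < dl,
    forall m, (m0 <= m)%N -> good_block (@sin_basis R) 1 (ST^~ w) m
  & forall m, (m0 <= m)%N -> good_block (@cos_basis R) (-1) (ST^~ w) m].
Proof.
move=> m00 hC y2 dl0.
pose H := 0 :: sym_range 1 (16 ^ m0).
pose B h := [set` `]y h - dl, y h + dl[].
have mB h : measurable (B h) by exact: measurable_itv.
have M0 : (0 < 16 ^ m0)%N by rewrite expn_gt0.
have uH : uniq H.
  rewrite /H /= sym_range_uniq// andbT; apply/negP => /mem_sym_range.
  by rewrite absz0.
have Hm h : h \in H -> (`|h| < 16 ^ m0)%N.
  by rewrite inE => /orP[/eqP ->//|/mem_sym_range/andP[]].
have mH h : (`|h| < 16 ^ m0)%N -> h \in H.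
  rewrite inE; case: h => [[//|n]|n] /= hn; rewrite ?orFb mem_cat.
    by apply/orP; left; apply/mapP; exists n.+1 => //; rewrite mem_index_iota.
  by apply/orP; right; apply/mapP; exists n.+1; rewrite ?mem_index_iota.
pose A := \big[setI/setT]_(j <- H) (ST j @^-1` B j).
have mA : measurable A by exact: (cylinder_measurable mST).
have BE h : ST h @^-1` B h = [set w | `|ST h w - y h| < dl].
  by apply/seteqP; split => w; rewrite /B /= ?in_itv/= ltr_distl.
have PA0 : (0 < P A)%E.
  rewrite /A indST//; apply: (big_ind (fun z => (0 < z)%E)) => //.
  - by move=> a c; exact: mule_gt0.
  - by move=> h _; rewrite BE; exact: sato_tate_ball_gt0.
pose Bad := unbounded_set `|` bad_tail m0.
have mBad : measurable Bad.
  by apply: measurableU; [exact: unbounded_set_measurable|exact: bad_tail_measurable].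
exists (A `\` Bad).
  split; first exact: measurableD.
  rewrite lt0e measure_ge0 andbT; apply/negP => /eqP PG.
  have PAB : P A = (P (A `\` Bad) + P (A `&` Bad))%E by exact: measureDI.
  rewrite PG add0e in PAB.
  have : (P A <= (fine (P A) / 2)%:E)%E.
    rewrite {1}PAB /Bad setIUr.
    apply: le_trans (measureU2 _ _ _) _; [apply: measurableI => //; exact: unbounded_set_measurable
      |apply: measurableI => //; exact: bad_tail_measurable|].
    have U0 : (P (A `&` unbounded_set) <= 0)%E.
      rewrite -unbounded_set_prob.
      have mU := unbounded_set_measurable.
      by apply: le_measure; [rewrite inE; exact: measurableI|rewrite inE|exact: subIsetr].
    by rewrite -[X in (_ <= X)%E]add0e; apply: leeD U0 _; exact: bad_tail_prob.
  have PAf : P A = (fine (P A))%:E by rewrite fineK// fin_num_measure.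
  rewrite PAf lte_fin in PA0; rewrite {1}PAf lee_fin; lra.
move=> w [Aw nBad].
have nU : ~ unbounded_set w by move=> h; apply: nBad; left.
have nT : ~ bad_tail m0 w by move=> h; apply: nBad; right.
split.
- exact: unbounded_setN.
- move=> h /mH hH; move: Aw; rewrite /A -bigcap_seq => /(_ h hH).
  by rewrite BE.
- move=> m m0m; apply: good_blockP => hb; apply: nT; exists (m - m0)%N => //.
  by left; rewrite subnKC.
- move=> m m0m; apply: good_blockP => hb; apply: nT; exists (m - m0)%N => //.
  by right; rewrite subnKC.
Qed.

Lemma pair_sum_dist (b : nat -> R -> R) (sg : R) (x y : int -> R) (M : nat) (t dl : R) :
  (forall n t, (0 < n)%N -> `|b n t| <= n%:R^-1) -> `|sg| = 1 ->
  (forall h : int, (`|h| < M)%N -> `|x h - y h| < dl) ->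
  `|pair_sum b sg x 1 M t - pair_sum b sg y 1 M t| <= 2 * dl * M%:R.
Proof.
move=> b_le sg1 xy; rewrite /pair_sum -sumrB.
apply: le_trans (ler_norm_sum _ _ _) _.
apply: (@le_trans _ _ (\sum_(1 <= n < M) (2 * dl))).
  rewrite big_nat [X in _ <= X]big_nat; apply: ler_sum => n /andP[n0 nM].
  have h1 : `|x (Posz n) - y (Posz n)| < dl by exact: xy.
  have h2 : `|x (- Posz n) - y (- Posz n)| < dl by apply: xy; rewrite abszN.
  rewrite -mulrBr normrM -[X in _ <= X]mul1r; apply: ler_pM => //.
    by apply: le_trans (b_le _ _ n0) _; rewrite invf_le1 ?ltr0n// ler1n.
  rewrite opprD addrACA -mulrBr; apply: le_trans (ler_normD _ _) _.
  by rewrite normrM sg1 mul1r; lra.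
rewrite sumr_const_nat -[_ *+ _]mulr_natr.
case: M xy => [|M] xy; first by rewrite sub0n.
have dl0 : 0 < dl by have := xy 0 isT; apply: le_lt_trans.
by apply: ler_wpM2l; [rewrite mulr_ge0// ltW|rewrite ler_nat leq_subr].
Qed.

(** As [y] vanishes from [L] on, only its frequencies below 16^m count: there [x] is close to [y],
    and beyond them the tail of [x] is small by itself. *)
Lemma pair_sum_approx (b : nat -> R -> R) (sg : R) (x y : int -> R) (m L N : nat) (t dl : R) :
  (forall n t, (0 < n)%N -> `|b n t| <= n%:R^-1) ->
  (forall n t s, (0 < n)%N -> `|b n t - b n s| <= `|t - s|) -> `|sg| = 1 ->
  (forall h : int, `|x h| <= 2) -> (forall k, (m <= k)%N -> good_block b sg x k) ->
  (forall h : int, (`|h| < 16 ^ m)%N -> `|x h - y h| < dl) ->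
  (forall n, (L <= n)%N -> y (Posz n) = 0 /\ y (- Posz n) = 0) ->
  (L <= 16 ^ m)%N -> (16 ^ m <= N)%N -> 0 <= t <= 1 ->
  `|pair_sum b sg x 1 N t - pair_sum b sg y 1 N t| <= 2 * dl * (16 ^ m)%:R + 130 / (2 ^ m)%:R.
Proof.
move=> b_le b_lip sg1 x2 good xy y0 Lm mN t01.
have M0 : (0 < 16 ^ m)%N by rewrite expn_gt0.
have y0' n : (16 ^ m <= n)%N -> y (Posz n) = 0 /\ y (- Posz n) = 0.
  by move=> mn; apply: y0; exact: leq_trans mn.
rewrite (pair_sum_truncate b sg t y0')//.
have -> : pair_sum b sg x 1 N t = pair_sum b sg x 1 (16 ^ m) t + pair_sum b sg x (16 ^ m) N t.
  by rewrite /pair_sum -big_cat_nat.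
rewrite addrAC; apply: le_trans (ler_normD _ _) _; apply: lerD.
  exact: pair_sum_dist.
exact: (tail_bound b_lip sg1 x2 good).
Qed.

Lemma pair_sum_cauchy (b : nat -> R -> R) (sg : R) (x : int -> R) (m0 m N M : nat) (t : R) :
  (forall n t s, (0 < n)%N -> `|b n t - b n s| <= `|t - s|) -> `|sg| = 1 ->
  (forall h : int, `|x h| <= 2) -> (forall k, (m0 <= k)%N -> good_block b sg x k) ->
  (m0 <= m)%N -> (16 ^ m <= N)%N -> (16 ^ m <= M)%N -> 0 <= t <= 1 ->
  `|pair_sum b sg x 1 N t - pair_sum b sg x 1 M t| <= 260 / (2 ^ m)%:R.
Proof.
move=> b_lip sg1 x2 good m0m mN mM t01.
have M0 : (0 < 16 ^ m)%N by rewrite expn_gt0.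
have E K : (16 ^ m <= K)%N ->
    pair_sum b sg x 1 K t = pair_sum b sg x 1 (16 ^ m) t + pair_sum b sg x (16 ^ m) K t.
  by move=> mK; rewrite /pair_sum -big_cat_nat.
rewrite (E N)// (E M)// opprD addrACA subrr add0r.
apply: le_trans (ler_normB _ _) _.
have h1 := tail_bound b_lip sg1 x2 good t01 m0m mN.
have h2 := tail_bound b_lip sg1 x2 good t01 m0m mM.
apply: le_trans (lerD h1 h2) _.
by rewrite -mulrDl; move: (2 ^ m)%:R^-1 => q; lra.
Qed.

Lemma pow2_gt (c : R) : exists m : nat, c < (2 ^ m)%:R.
Proof.
exists (Num.truncn c).+1; apply: lt_le_trans (truncnS_gt c) _.
by rewrite ler_nat ltnW// ltn_expl.
Qed.

Lemma support_supset (f : R -> R[i]) :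
  c01 (fun t => complex.Re (f t)) -> c01 (fun t => complex.Im (f t)) ->
  f 0 = 0 -> (exists x : R, -2 <= x <= 2 /\ f 1 = x%:C) ->
  (forall h : int, h != 0 ->
        let g := fun t : R => f t - t%:C * f 1 in
        complex.Re (fourier_coef g h) = 0 /\
        `|fourier_coef g h| <= ((pi * `|h|%:~R)^-1)%:C) ->
  in_support_K P ST f.
Proof.
move=> c1 c2 f0 f1 fc eps eps0.
(* Real and imaginary parts will each be within 3 e of [f]; 6 e is at most eps / 2, which leaves a
   margin above 1/(p+1). *)
have e0 : 0 < eps / 16 by rewrite divr_gt0.
set e := eps / 16 in e0.
have [L [y [y2 yL hR hI]]] := support_approx c1 c2 f0 f1 fc e0.
have [ma hma] := pow2_gt (8 * bad_const R).
have [mb hmb] := pow2_gt (130 / e).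
(* [L] places the approximant below frequency 16^m0, [ma] makes the bad tail cost at most half of
   the probability, and [mb] makes the tail at most [e]. *)
pose m0 := (L + ma + mb).+1.
have pw a : (a <= m0)%N -> (2 ^ a)%:R <= (2 ^ m0)%:R :> R by move=> am; rewrite ler_nat leq_exp2l.
have hC : 8 * bad_const R <= (2 ^ m0)%:R.
  by apply: le_trans (ltW hma) (pw _ _); rewrite /m0; lia.
have q0 : 0 < (2 ^ m0)%:R :> R by rewrite ltr0n expn_gt0.
have hq : 130 / (2 ^ m0)%:R <= e.
  rewrite ler_pdivrMr// mulrC -ler_pdivrMr//.
  by apply: le_trans (ltW hmb) (pw _ _); rewrite /m0; lia.
have Lm : (L <= 16 ^ m0)%N.
  by apply: leq_trans (ltnW (@ltn_expl 16 m0 isT)); rewrite /m0; lia.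
have m00 : (0 < m0)%N by [].
clearbody m0.
have M0 : 0 < (16 ^ m0)%:R :> R by rewrite ltr0n expn_gt0.
have M1 : 0 < 1 + 2 * (16 ^ m0)%:R :> R by lra.
(* The term 1 accounts for the zeroth variable, the term 2 * 16^m0 for the low frequencies in
   [pair_sum_dist]. *)
pose dl := e / (1 + 2 * (16 ^ m0)%:R).
have dl0 : 0 < dl by rewrite divr_gt0.
have dlE : dl * (1 + 2 * (16 ^ m0)%:R) = e by rewrite divfK// gt_eqF.
clearbody dl.
have [G [mG PG] hG] := prescribed_prob_gt0 m00 hC y2 dl0.
apply: lt_le_trans PG _; apply: le_measure; rewrite ?inE//.
  exact: support_event_measurable.
move=> w /hG[x2 xy g1 g2] /=.
have n1 : `|1 : R| = 1 by exact: normr1.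
have n2 : `|-1 : R| = 1 by rewrite normrN normr1.
apply/(support_eventE ST eps w c1 c2); split.
  (* Twice the constant 260 of [pair_sum_cauchy], for the real and the imaginary part. *)
  move=> p; have [m hm] := pow2_gt (520 * p.+1%:R).
  pose m' := maxn m0 m; exists (16 ^ m')%N => N M mN mM t t01.
  have m'0 : (m0 <= m')%N by exact: leq_maxl.
  have Q0 : 0 < (2 ^ m')%:R :> R by rewrite ltr0n expn_gt0.
  have Q1 : 520 / (2 ^ m')%:R <= p.+1%:R^-1 :> R.
    rewrite ler_pdivrMr// mulrC ler_pdivlMr//; apply: le_trans (ltW hm) _.
    by rewrite ler_nat leq_exp2l// leq_maxr.
  have h1 := pair_sum_cauchy (@sin_basis_lipschitz R) n1 x2 g1 m'0 (leqW mN) (leqW mM) t01.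
  have h2 := pair_sum_cauchy (@cos_basis_lipschitz R) n2 x2 g2 m'0 (leqW mN) (leqW mM) t01.
  apply: le_trans (cabs_le _) _; rewrite Re_sub Im_sub !K_partialE /= /reK /imK.
  rewrite opprD addrACA subrr add0r; apply: le_trans (lerD h1 h2) _.
  by apply: le_trans Q1; rewrite -mulrDl; move: ((2 ^ m')%:R^-1) => q; lra.
have eps20 : 0 < eps / 2 by rewrite divr_gt0.
have [p hp] := inv_succ_lt eps20.
exists p, (16 ^ m0)%N => N mN t t01.
have h1 := pair_sum_approx (@sin_basis_le R) (@sin_basis_lipschitz R)
  n1 x2 g1 xy yL Lm (leqW mN) t01.
have h2 := pair_sum_approx (@cos_basis_le R) (@cos_basis_lipschitz R)
  n2 x2 g2 xy yL Lm (leqW mN) t01.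
have h3 := hR N (leq_trans Lm mN) t t01.
have h4 := hI N (leq_trans Lm mN) t t01.
have h5 : `|ST 0 w - y 0| < dl by apply: xy; rewrite absz0 expn_gt0.
have h6 : `|t * ST 0 w - t * y 0| <= dl.
  rewrite -mulrBr normrM; move: t01 => /andP[t0 t1]; rewrite (ger0_norm t0).
  by apply: le_trans (ltW h5); rewrite ler_piMl.
apply: le_trans (cabs_le _) _; rewrite Re_sub Im_sub !K_partialE /=.
rewrite /reK in h3 *; rewrite /imK in h4 *.
have r1 : `|t * ST 0 w + pair_sum (@sin_basis R) 1 (ST^~ w) 1 N.+1 t - complex.Re (f t)| <= 3 * e.
  move: h1 h3 h6; set a := pair_sum _ _ _ _ _ _; set a' := pair_sum _ _ _ _ _ _.
  set u := t * ST 0 w; set u' := t * y 0; set v := complex.Re (f t).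
  rewrite !ler_norml => /andP[k1 k2] /andP[k3 k4] /andP[k5 k6].
  by apply/andP; split; lra.
have r2 : `|pair_sum (@cos_basis R) (-1) (ST^~ w) 1 N.+1 t - complex.Im (f t)| <= 3 * e.
  move: h2 h4; set a := pair_sum _ _ _ _ _ _; set a' := pair_sum _ _ _ _ _ _.
  set v := complex.Im (f t).
  rewrite !ler_norml => /andP[k1 k2] /andP[k3 k4].
  by apply/andP; split; lra.
apply: le_trans (lerD r1 r2) _.
by move: (p.+1%:R^-1) hp => z hz; rewrite /e; lra.
Qed.

End support.

Theorem theorem1p1 (d : measure_display) (T : measurableType d) (R : realType)
  (P : probability T R) (ST : int -> T -> R)
  (ST_meas : forall h, measurable_fun setT (ST h))
  (ST_indep : mutually_independent P ST)
  (ST_law : forall h, sato_tate_law P (ST h))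
  (f : R -> R[i]) (f_cont : {within `[0%R, 1%R], continuous (f : R -> (R[i])^o)}) :
  in_support_K P ST f <->
  [/\ f 0 = 0,
      exists x : R, -2 <= x <= 2 /\ f 1 = x%:C
    & forall h : int, h != 0 ->
        let g := fun t : R => f t - t%:C * f 1 in
        complex.Re (fourier_coef g h) = 0 /\
        `|fourier_coef g h| <= ((pi * `|h|%:~R)^-1)%:C].
Proof.
have [c1 c2] := within01_complex f_cont.
split=> [|[f0 f1 fc]]; first exact: support_subset.
exact: support_supset.
Qed.
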